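(* Let $R$ be a commutative Noetherian ring with identity, $\mathfrak{a}$ an ideal of $R$ and $M$ a finitely generated $R$-module with $\mathrm{cd}(\mathfrak{a},M)=\mathrm{ara}(\mathfrak{a},M)$. Consider the following conditions: (i) $M$ is $\mathfrak{a}$-relative quasi Buchsbaum. (ii) There is an $\mathfrak{a}$-s.o.p of $M$ contained in $\mathfrak{a}^2$ which is an $\mathfrak{a}$-weak sequence on $M$. (iii) $\mathfrak{a}\,H^i_{\mathfrak{a}}(M)=0$ for all $0\le i<\mathrm{cd}(\mathfrak{a},M)$. Then (i) implies (ii), and (ii) implies (iii). Furthermore, if $\mathfrak{a}$ is contained in the Jacobson radical of $R$, then (iii) implies (i).
   Context: $H^i_{\mathfrak{a}}(M)$ is local cohomology. $\mathrm{cd}(\mathfrak{a},M)$ is the supremum of the integers $i\ge 0$ with $H^i_{\mathfrak{a}}(M)\ne 0$ (with $\sup\emptyset=-\infty$). $\mathrm{ara}(\mathfrak{a},M)$ is the infimum of the integers $n\ge 0$ for which there exist $x_1,\ldots,x_n\in R$ such that $\langle x_1,\ldots,x_n\rangle$ and $\mathfrak{a}$ have the same radical in $R/\mathrm{Ann}_R M$. With $c=\mathrm{cd}(\mathfrak{a},M)$, a sequence $x_1,\ldots,x_c$ of elements of $\mathfrak{a}$ is an $\mathfrak{a}$-relative system of parameters ($\mathfrak{a}$-s.o.p) of $M$ if $\langle x_1,\ldots,x_c\rangle$ and $\mathfrak{a}$ have the same radical in $R/\mathrm{Ann}_R M$. A sequence $x_1,\ldots,x_r$ in $R$ is an $\mathfrak{a}$-weak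 sequence on $M$ if $\langle x_1,\ldots,x_{i-1}\rangle M:_M x_i\subseteq\langle x_1,\ldots,x_{i-1}\rangle M:_M\mathfrak{a}$ for all $i=1,\ldots,r$. $M$ is $\mathfrak{a}$-relative quasi Buchsbaum if $\mathrm{cd}(\mathfrak{a},M)=\mathrm{ara}(\mathfrak{a},M)$ and every $\mathfrak{a}$-s.o.p of $M$ contained in $\mathfrak{a}^2$ is an $\mathfrak{a}$-weak sequence on $M$. *)

(* Defs.v *)
From HB Require Import structures.
From mathcomp Require Import all_boot all_order all_algebra.
From mathcomp Require Import generic_quotient ring_quotient.
From mathcomp Require Import boolp classical_sets functions constructive_ereal.

Set Implicit Arguments.
Unset Strict Implicit.
Unset Printing Implicit Defensive.

Import Order.TTheory GRing.Theory Num.Theory.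
Local Open Scope classical_set_scope.
Local Open Scope ring_scope.
Local Open Scope quotient_scope.

(* Submodules and ideals are Prop-valued sets. An ideal is a submodule of the
   regular module [R^o]; the unit ideal is allowed, unlike in [idealr]. *)

Section Submodules.
Variables (R : comPzRingType) (M : lmodType R).

Definition submodule (N : set M) : Prop :=
  [/\ N 0, forall x y, N x -> N y -> N (x + y)
    & forall (r : R) x, N x -> N (r *: x)].

Definition span (S : set M) : set M := smallest submodule S.

Definition smul (I : set R) (N : set M) : set M :=
  span [set r *: m | r in I & m in N].

Lemma submodule_span (S : set M) : submodule (span S).
Proof.
split=> [X [[] //]|x y Sx Sy X [sX SX]|r x Sx X [sX SX]].
- by case: (sX) => _ + _; apply; [apply: Sx|apply: Sy].
- by case: (sX) => _ _; apply; apply: Sx.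
Qed.

Lemma span_min (S N : set M) : submodule N -> S `<=` N -> span S `<=` N.
Proof. by move=> sN SN x; apply. Qed.

Definition finitely_generated : Prop := exists s : seq M, span [set` s] = setT.

Definition annihilator : set R := [set r | forall m : M, r *: m = 0].

End Submodules.

Arguments finitely_generated {R} M.
Arguments annihilator {R} M.

Section Ideals.
Variable R : comPzRingType.

Definition ideal (I : set R) : Prop := @submodule R R^o I.

Definition ideal_gen (s : seq R) : set R := @span R R^o [set` s].

Fixpoint ideal_pow (a : set R) (n : nat) : set R :=
  if n is k.+1 then @smul R R^o a (ideal_pow a k) else setT.

Lemma ideal_ideal_pow (a : set R) n : ideal (ideal_pow a n).
Proof. by case: n => [|n]; [split|apply: submodule_span]. Qed.

Lemma sub_ideal_pow (a : set R) n m :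
  (n <= m)%N -> ideal_pow a m `<=` ideal_pow a n.
Proof.
move=> /subnK <-; elim: (m - n)%N => // k IH x /= kx.
apply: IH; apply: span_min kx; first exact: ideal_ideal_pow.
move=> _ [r _ [s ks <-]].
by case: (ideal_ideal_pow a (k + n)) => _ _; apply.
Qed.

Definition noetherian : Prop :=
  forall I : set R, ideal I -> exists s : seq R, I = ideal_gen s.

Definition maximal_ideal (m : set R) : Prop :=
  [/\ ideal m, m <> setT &
      forall I : set R, ideal I -> m `<=` I -> I = m \/ I = setT].

Definition jacobson_radical : set R := \bigcap_(m in maximal_ideal) m.

(* The preimage in [R] of the radical of the image of [J] in [R / I]. *)
Definition radical_mod (I J : set R) : set R :=
  [set r | exists n : nat, exists2 y, J y & I (r ^+ n - y)].

End Ideals.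

Arguments jacobson_radical R : clear implicits.

(* The submodule [N] as a module, and the quotient module [M / N]. *)

Section SubQuotient.
Variables (R : comPzRingType) (M : lmodType R).

Record submod := Submod { submod_set :> set M; submodP : submodule submod_set }.

Variable N : submod.

Definition mem_submod : pred M := fun x => `[< submod_set N x >].

Lemma mem_submod_closed : submod_closed mem_submod.
Proof.
case: (submodP N) => N0 ND NZ; split; first exact/asboolP.
by move=> r x y /asboolP Nx /asboolP Ny; apply/asboolP/ND => //; apply: NZ.
Qed.

HB.instance Definition _ :=
  GRing.isSubmodClosed.Build R M mem_submod mem_submod_closed.

Definition subm := {x : M | mem_submod x}.
HB.instance Definition _ := Choice.on subm.
HB.instance Definition _ := SubType.on subm.
HB.instance Definition _ := [SubChoice_isSubLmodule of subm by <:].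

Definition quotm := Quotient.quot (GRing.ZmodClosed.clone M mem_submod _).
HB.instance Definition _ := Choice.on quotm.
HB.instance Definition _ := GRing.Zmodule.on quotm.
HB.instance Definition _ := EqQuotient.on quotm.


Lemma pi_quotm_eq (x y : M) : (\pi_quotm x = \pi_quotm y) <-> submod_set N (x - y).
Proof.
split=> [/eqmodP /asboolP //|Nxy].
by apply/eqmodP; apply/asboolP.
Qed.

Definition scale_quotm (r : R) (x : quotm) : quotm := \pi_quotm (r *: repr x).

Lemma pi_quotmZ (r : R) (x : M) :
  scale_quotm r (\pi_quotm x) = \pi_quotm (r *: x).
Proof.
apply/pi_quotm_eq; rewrite -scalerBr.
case: (submodP N) => _ _; apply.
by apply/pi_quotm_eq; rewrite reprK.
Qed.

Lemma pi_quotmD (x y : M) : \pi_quotm x + \pi_quotm y = \pi_quotm (x + y).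
Proof. by rewrite !piE. Qed.

Lemma scale_quotmA r s (x : quotm) :
  scale_quotm r (scale_quotm s x) = scale_quotm (r * s) x.
Proof. by rewrite -[x]reprK (pi_quotmZ s) !pi_quotmZ scalerA. Qed.

Lemma scale1_quotm : left_id 1 scale_quotm.
Proof. by move=> x; rewrite -[x]reprK !pi_quotmZ scale1r. Qed.

Lemma scale_quotmDr : right_distributive scale_quotm +%R.
Proof.
move=> r x y; rewrite -[x]reprK -[y]reprK.
by rewrite pi_quotmD !pi_quotmZ pi_quotmD scalerDr.
Qed.

Lemma scale_quotmDl (x : quotm) :
  {morph scale_quotm^~ x : r s / r + s >-> r + s}.
Proof.
by move=> r s; rewrite -[x]reprK !pi_quotmZ pi_quotmD scalerDl.
Qed.

HB.instance Definition _ := GRing.Zmodule_isLmodule.Build R quotm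
  scale_quotmA scale1_quotm scale_quotmDr scale_quotmDl.

End SubQuotient.

Section Homology.
Variable R : comPzRingType.

Section Maps.
Variables (A B : lmodType R) (f : {linear A -> B}).

Lemma submodule_ker : submodule [set x | f x = 0].
Proof.
split=> [|x y /= fx fy|r x /= fx]; first exact: linear0.
- by rewrite linearD fx fy addr0.
- by rewrite linearZ_LR fx scaler0.
Qed.

Definition kerm : submod A := Submod submodule_ker.

Lemma submodule_im : submodule (range f).
Proof.
split=> [|_ _ [x _ <-] [y _ <-]|r _ [x _ <-]].
- by exists 0 => //; exact: linear0.
- by exists (x + y) => //; rewrite linearD.
- by exists (r *: x) => //; rewrite linearZ_LR.
Qed.

Definition imm : submod B := Submod submodule_im.

Lemma submodule_preim (N : submod B) : submodule (f @^-1` N).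
Proof.
case: (submodP N) => N0 ND NZ; split=> [|x y Nx Ny|r x Nx]; rewrite /preimage /=.
- by rewrite linear0.
- by rewrite linearD; apply: ND.
- by rewrite linearZ_LR; apply: NZ.
Qed.

Definition preimm (N : submod B) : submod A := Submod (submodule_preim N).

End Maps.

(* [ker g / im f]; meaningful when [g \o f = 0]. *)
Definition homology (A B C : lmodType R)
    (f : {linear A -> B}) (g : {linear B -> C}) : lmodType R :=
  quotm (preimm (val : {linear subm (kerm g) -> B}) (imm f)).

End Homology.

(* The [a]-torsion functor. *)

Section Torsion.
Variables (R : comPzRingType) (a : set R).

Lemma submodule_torsion (A : lmodType R) :
  submodule [set x : A | exists n, forall r, ideal_pow a n r -> r *: x = 0].
Proof.
split=> [|x y /= [n xn] [m ym]|r x /= [n xn]].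
- by exists 0%N => r _; rewrite scaler0.
- exists (maxn n m) => r ar; rewrite scalerDr xn ?ym ?addr0 //.
  + by apply: sub_ideal_pow ar; exact: leq_maxr.
  + by apply: sub_ideal_pow ar; exact: leq_maxl.
- by exists n => s /xn xs; rewrite scalerA mulrC -scalerA xs scaler0.
Qed.

Definition torsion (A : lmodType R) : submod A := Submod (submodule_torsion A).

Section Map.
Variables (A B : lmodType R) (f : {linear A -> B}).

Lemma torsion_map_subproof (x : subm (torsion A)) :
  mem_submod (torsion B) (f (val x)).
Proof.
case: x => x /= /asboolP [n xn]; apply/asboolP; exists n => r ar.
by rewrite -linearZ_LR xn // linear0.
Qed.

Definition torsion_map (x : subm (torsion A)) : subm (torsion B) :=
  Sub (f (val x)) (torsion_map_subproof x).

Lemma torsion_map_linear : linear torsion_map.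
Proof. by move=> r x y; apply: val_inj; rewrite /= linearP. Qed.

HB.instance Definition _ := GRing.isLinear.Build R
  (subm (torsion A)) (subm (torsion B)) *:%R torsion_map torsion_map_linear.

End Map.

End Torsion.

Arguments torsion_map {R} a {A B} f.

Section InjectiveResolutions.
Variable R : comPzRingType.

Definition injective_module (E : lmodType R) : Prop :=
  forall (A B : lmodType R) (i : {linear A -> B}) (f : {linear A -> E}),
    injective i -> exists g : {linear B -> E}, forall x, g (i x) = f x.

Record injective_resolution (M : lmodType R) := InjectiveResolution {
  res_obj : nat -> lmodType R;
  res_diff : forall n, {linear res_obj n -> res_obj n.+1};
  res_aug : {linear M -> res_obj 0};
  res_injective : forall n, injective_module (res_obj n);
  res_aug_inj : injective res_aug;
  res_exact0 : [set x | res_diff 0 x = 0] = range res_aug;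
  res_exactS : forall n, [set x | res_diff n.+1 x = 0] = range (res_diff n)
}.

End InjectiveResolutions.

(* Existence of injective resolutions. The cogenerator is Q / Z; the modules
   Hom_Z(R, (Q / Z)^I) are injective. *)

Definition qint : pred rat := fun x => x \is a Num.int.

Lemma qint_closed : zmod_closed qint.
Proof. by split=> [|x y]; [exact: rpred0|exact: rpredB]. Qed.
HB.instance Definition _ := GRing.isZmodClosed.Build rat qint qint_closed.

Definition QZ := Quotient.quot (GRing.ZmodClosed.clone rat qint _).
HB.instance Definition _ := Choice.on QZ.
HB.instance Definition _ := GRing.Zmodule.on QZ.
HB.instance Definition _ := EqQuotient.on QZ.

Lemma pi_QZ_eq (x y : rat) : (\pi_QZ x = \pi_QZ y) <-> qint (x - y).
Proof. by split=> [/eqmodP //|xy]; apply/eqmodP. Qed.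

Lemma pi_QZMn (x : rat) n : \pi_QZ x *+ n = \pi_QZ (x *+ n).
Proof.
elim: n => [|n IH]; first by rewrite !mulr0n; apply/esym; rewrite !piE.
by rewrite !mulrS IH !piE.
Qed.

Lemma QZ_divisible (d : QZ) n : (0 < n)%N -> exists e : QZ, e *+ n = d.
Proof.
move=> n0; exists (\pi_QZ (repr d / n%:R)).
by rewrite pi_QZMn -(mulr_natr (_ / _)) divfK ?reprK // pnatr_eq0 -lt0n.
Qed.

Lemma QZ_torsion n : (1 < n)%N -> exists2 e : QZ, e != 0 & e *+ n = 0.
Proof.
move=> n1; have n0 : n%:R != 0 :> rat by rewrite pnatr_eq0 -lt0n ltnW.
have pi0 : \pi_QZ 0 = 0 by rewrite !piE.
exists (\pi_QZ (n%:R^-1)).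
  apply/eqP; rewrite -pi0 => /pi_QZ_eq; rewrite subr0 /qint => /intrP [z zE].
  have : 0 < n%:R^-1 :> rat by rewrite invr_gt0 ltr0n ltnW.
  have : n%:R^-1 < 1 :> rat by rewrite invf_lt1 ?ltr1n // ltr0n ltnW.
  by rewrite zE ltr0z -[1]/(1%:~R) ltr_int; case: (z) => [[|[]]|].
rewrite pi_QZMn -pi0; apply/pi_QZ_eq.
by rewrite subr0 -(mulr_natr _^-1) mulVf.
Qed.

Section CharacterExtension.
Variable B : zmodType.
Implicit Types (G : set (B * QZ)) (b : B) (d e : QZ).

Definition partial_hom G : Prop :=
  [/\ G 0, forall p q, G p -> G q -> G (p - q) & forall d, G (0, d) -> d = 0].

Definition adjoin_graph G b e : set (B * QZ) :=
  [set p | exists2 q, G q & exists k : int, p = q + (b *~ k, e *~ k)].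

Lemma partial_homMz G p (k : int) : partial_hom G -> G p -> G (p *~ k).
Proof.
case=> G0 GB _ Gp.
have GN q : G q -> G (- q) by rewrite -sub0r; exact: GB.
have GM n : G (p *+ n).
  elim: n => [//|n IH]; rewrite mulrS -[X in _ + X]opprK.
  by apply: GB => //; apply: GN.
by case: k => n; [exact: GM|apply/GN/GM].
Qed.

Lemma pair_mulrz (x : B) (d : QZ) (k : int) : (x, d) *~ k = (x *~ k, d *~ k).
Proof.
have M n : (x, d) *+ n = (x *+ n, d *+ n).
  by elim: n => // n IH; rewrite !mulrS IH.
by case: k => n; [exact: M|rewrite /intmul M].
Qed.

Lemma pairB (x y : B) (c d : QZ) : (x, c) - (y, d) = (x - y, c - d).
Proof. by []. Qed.

Lemma adjoin_graph_hom G b e : partial_hom G ->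
  (forall k d, G (b *~ k, d) -> d = e *~ k) -> partial_hom (adjoin_graph G b e).
Proof.
move=> [G0 GB Gf] be; split.
- by exists 0 => //; exists 0; rewrite !mulr0z addr0.
- move=> _ _ [p Gp [k ->]] [q Gq [l ->]]; exists (p - q); first exact: GB.
  by exists (k - l); rewrite !mulrzBr opprD addrACA.
- move=> d [[x c] Gq [k []]] /eqP.
  rewrite eq_sym addrC addr_eq0 => /eqP bk ->.
  have /be : G (b *~ k, - c).
    by rewrite bk -[X in G X]/(- (x, c)) -sub0r; exact: GB.
  by move=> <-; rewrite subrr.
Qed.

Lemma sub_adjoin_graph G b e : G `<=` adjoin_graph G b e.
Proof. by move=> p Gp; exists p => //; exists 0; rewrite !mulr0z addr0. Qed.

Lemma adjoin_graph_mem G b e : partial_hom G -> adjoin_graph G b e (b, e).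
Proof. by case=> G0 _ _; exists 0 => //; exists 1; rewrite add0r !mulr1z. Qed.

Lemma adjoin_torsion G b n d0 e : partial_hom G -> (0 < n)%N ->
  G (b *+ n, d0) ->
  (forall m d, (0 < m < n)%N -> ~ G (b *+ m, d)) ->
  e *+ n = d0 -> forall k d, G (b *~ k, d) -> d = e *~ k.
Proof.
move=> hG n0 Gn nmin en k d Gk; have [G0 GB Gf] := hG.
pose q := (k %/ n)%Z; pose r := (k %% n)%Z.
have kE : k = q * n + r by exact: divz_eq.
have : G (b *~ r, d - d0 *~ q).
  have := GB _ _ Gk (partial_homMz q hG Gn).
  rewrite pair_mulrz pairB pmulrn -mulrzA -mulrzBr.
  by rewrite {1}kE mulrC addrC addKr.
have : 0 <= r by rewrite modz_ge0 // eqz_nat -lt0n.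
have : r < n by rewrite ltz_pmod.
rewrite {}kE; case: r => // -[_ _|m]; last first.
  by rewrite ltz_nat => mn _ /nmin; rewrite mn => /(_ isT).
rewrite mulr0z => /Gf /eqP; rewrite subr_eq0 => /eqP ->.
by rewrite addr0 mulrC mulrzA -pmulrn en.
Qed.

Lemma adjoin_free G b e : partial_hom G ->
  (forall m d, (0 < m)%N -> ~ G (b *+ m, d)) ->
  forall k d, G (b *~ k, d) -> d = e *~ k.
Proof.
move=> hG nG k d Gk; have [G0 GB Gf] := hG.
case: k Gk => [[|m]|m] Gk.
- by rewrite mulr0z; apply: Gf.
- by case: (nG m.+1 d).
- case: (nG m.+1 (- d)) => //.
  have := partial_homMz (-1) hG Gk.
  by rewrite pair_mulrz !mulrN1z NegzE mulrNz opprK.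
Qed.

Lemma adjoin_exists G b : partial_hom G ->
  exists e, forall k d, G (b *~ k, d) -> d = e *~ k.
Proof.
move=> hG.
have [[n [n0 [d0 Gn]] nmin]|nG] := pselect (exists2 n,
    (0 < n)%N /\ (exists d, G (b *+ n, d)) &
    forall m d, (0 < m < n)%N -> ~ G (b *+ m, d)).
  have [e en] := QZ_divisible d0 n0.
  by exists e; exact: (adjoin_torsion hG n0 Gn nmin en).
exists 0; apply: adjoin_free => // m d m0 Gm; apply: nG.
have ex : exists n, (0 < n)%N && `[< exists d, G (b *+ n, d) >].
  by exists m; rewrite m0; apply/asboolP; exists d.
case: (ex_minnP ex) => n /andP[n0 /asboolP Gn] nmin; exists n => // l c.
case/andP=> l0 ln Gl; have := nmin l.
rewrite l0 leqNgt ln /= => F; suff : false by [].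
by apply: F; apply/asboolP; exists c.
Qed.

Definition additive_fun (V W : zmodType) (phi : V -> W) : Prop :=
  forall x y, phi (x + y) = phi x + phi y.

Lemma partial_hom_extend G : partial_hom G ->
  exists2 phi : B -> QZ, additive_fun phi & forall x d, G (x, d) -> phi x = d.
Proof.
move=> hG.
have [|H [hH Hmax]] := @Zorn_bigcup _ [set X | partial_hom (X `|` G)].
  move=> F FP Ftot.
  have [->|/set0P [X0 FX0]] := eqVneq F set0.
    by rewrite /= bigcup_set0 set0U.
  have mem2 p q : (\bigcup_(X in F) X `|` G) p -> (\bigcup_(X in F) X `|` G) q ->
      exists2 X, F X & (X `|` G) p /\ (X `|` G) q.
    move=> [[X FX Xp]|Gp] [[Y FY Yq]|Gq].
    - have [XY|YX] := Ftot _ _ FX FY.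
      + by exists Y => //; split; left => //; exact: XY.
      + by exists X => //; split; left => //; exact: YX.
    - by exists X => //; split; [left|right].
    - by exists Y => //; split; [right|left].
    - by exists X0 => //; split; right.
  have sub X p : F X -> (X `|` G) p -> (\bigcup_(X in F) X `|` G) p.
    by move=> FX [Xp|Gp]; [left; exists X|right].
  split.
  - by right; case: hG.
  - move=> p q hp hq; have [X FX [Xp Xq]] := mem2 _ _ hp hq.
    by apply: (sub X) => //; case: (FP _ FX) => _ + _; apply.
  - move=> d hd; have [X FX [Xd _]] := mem2 _ _ hd hd.
    by case: (FP _ FX) => _ _; apply.
set K := H `|` G in hH.
have Ktot b : exists d, K (b, d).
  apply: contrapT => nb.
  have [e eP] := adjoin_exists b hH.
  have hA := adjoin_graph_hom hH eP.
  have KA := @sub_adjoin_graph K b e.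
  apply: (Hmax (adjoin_graph K b e)).
    split=> [p Hp|/(_ (b, e)) Hbe]; first by apply: KA; left.
    by apply: nb; exists e; left; apply: Hbe; exact: adjoin_graph_mem.
  rewrite /= (_ : _ `|` _ = adjoin_graph K b e) //.
  by apply/setUidPl => p Gp; apply: KA; right.
have [K0 KB Kf] := hH.
have Kfun b d d' : K (b, d) -> K (b, d') -> d = d'.
  move=> h h'; apply/eqP; rewrite -subr_eq0; apply/eqP/Kf.
  by have := KB _ _ h h'; rewrite pairB subrr.
have [phi phiP] := choice Ktot.
have KN p : K p -> K (- p) by rewrite -sub0r; exact: KB.
exists phi => [x y|x d Gxd].
  apply: (Kfun (x + y)) => //.
  have := KB _ _ (phiP x) (KN _ (phiP y)).
  by rewrite opprK.
by apply: (Kfun x) => //; right.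
Qed.

Lemma character_separates (N : set B) (x : B) :
  N 0 -> (forall y z, N y -> N z -> N (y - z)) -> ~ N x ->
  exists phi : B -> QZ,
    [/\ additive_fun phi, forall y, N y -> phi y = 0 & phi x <> 0].
Proof.
move=> N0 NB Nx; pose G : set (B * QZ) := [set p | N p.1 /\ p.2 = 0].
have hG : partial_hom G.
  split=> [//|p q [Np p0] [Nq q0]|d [_ /=]//].
  by split=> /=; [exact: NB|rewrite p0 q0 subrr].
suff [e e0 eP] : exists2 e : QZ, e != 0 &
    forall k d, G (x *~ k, d) -> d = e *~ k.
  have [phi phiD phiG] := partial_hom_extend (adjoin_graph_hom hG eP).
  exists phi; split=> // [y Ny|].
    by apply: phiG; apply: sub_adjoin_graph.
  have -> : phi x = e by apply: phiG; exact: adjoin_graph_mem.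
  exact/eqP.
have [[n [n0 Nn] nmin]|nG] := pselect (exists2 n,
    (0 < n)%N /\ N (x *+ n) & forall m, (0 < m < n)%N -> ~ N (x *+ m)).
  have n1 : (1 < n)%N by case: n n0 Nn {nmin} => [|[]].
  have [e e0 en] := QZ_torsion n1; exists e => //.
  by apply: (@adjoin_torsion G x n 0 e) => // m d /nmin Nm [].
have [e e0 _] := @QZ_torsion 2 isT; exists e => //.
apply: adjoin_free => // m d m0 [/= Nm _]; apply: nG.
have ex : exists n, (0 < n)%N && `[< N (x *+ n) >].
  by exists m; rewrite m0; apply/asboolP.
case: (ex_minnP ex) => n /andP[n0 /asboolP Nn] nmin; exists n => // l.
case/andP=> l0 ln Nl; have := nmin l.
rewrite l0 leqNgt ln /= => F; suff : false by [].
by apply: F; apply/asboolP.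
Qed.

End CharacterExtension.

Lemma additive_fun0 (V W : zmodType) (phi : V -> W) :
  additive_fun phi -> phi 0 = 0.
Proof. by move=> D; apply: (addIr (phi 0)); rewrite -D !add0r. Qed.

Lemma additive_funN (V W : zmodType) (phi : V -> W) x :
  additive_fun phi -> phi (- x) = - phi x.
Proof.
by move=> D; apply: (addIr (phi x)); rewrite -D !addNr additive_fun0.
Qed.

Section Cofree.
Variables (R : comPzRingType) (I : Type).

Definition cofree_pred (f : I -> R -> QZ) : bool :=
  `[< forall i, additive_fun (f i) >].

Definition cofree := {f : I -> R -> QZ | cofree_pred f}.
HB.instance Definition _ := gen_eqMixin cofree.
HB.instance Definition _ := gen_choiceMixin cofree.

Definition cofree_fun (f : cofree) : I -> R -> QZ := sval f.

Lemma cofree_additive (f : cofree) i : additive_fun (cofree_fun f i).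
Proof. by case: f => f /= /asboolP. Qed.

Lemma cofreeP (f g : cofree) :
  (forall i r, cofree_fun f i r = cofree_fun g i r) -> f = g.
Proof.
case: f g => f hf [g hg] fg; apply: eq_exist.
by apply/funext => i; apply/funext => r; exact: fg.
Qed.

Definition Cofree (f : I -> R -> QZ) (fD : forall i, additive_fun (f i)) :
  cofree := exist cofree_pred f (introT (asboolP _) fD).

Let zero_subproof (i : I) : additive_fun (fun r : R => 0 : QZ).
Proof. by move=> x y; rewrite addr0. Qed.
Let opp_subproof (f : cofree) i : additive_fun (fun r => - cofree_fun f i r).
Proof. by move=> x y; rewrite cofree_additive opprD. Qed.
Let add_subproof (f g : cofree) i :
  additive_fun (fun r => cofree_fun f i r + cofree_fun g i r).
Proof. by move=> x y; rewrite !cofree_additive addrACA. Qed.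
Let scale_subproof (s : R) (f : cofree) i :
  additive_fun (fun r => cofree_fun f i (r * s)).
Proof. by move=> x y; rewrite mulrDl cofree_additive. Qed.

Definition cofree_zero := Cofree zero_subproof.
Definition cofree_opp f := Cofree (opp_subproof f).
Definition cofree_add f g := Cofree (add_subproof f g).
Definition cofree_scale s f := Cofree (scale_subproof s f).

Let addA : associative cofree_add.
Proof. by move=> f g h; apply: cofreeP => i r; exact: addrA. Qed.
Let addC : commutative cofree_add.
Proof. by move=> f g; apply: cofreeP => i r; exact: addrC. Qed.
Let add0 : left_id cofree_zero cofree_add.
Proof. by move=> f; apply: cofreeP => i r; exact: add0r. Qed.
Let addN : left_inverse cofree_zero cofree_opp cofree_add.
Proof. by move=> f; apply: cofreeP => i r; exact: addNr. Qed.
HB.instance Definition _ := GRing.isZmodule.Build cofree addA addC add0 addN.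

Let scaleA s t f : cofree_scale s (cofree_scale t f) = cofree_scale (s * t) f.
Proof. by apply: cofreeP => i r; rewrite /cofree_fun /= mulrA. Qed.
Let scale1 : left_id 1 cofree_scale.
Proof. by move=> f; apply: cofreeP => i r; rewrite /cofree_fun /= mulr1. Qed.
Let scaleDr : right_distributive cofree_scale +%R.
Proof. by move=> s f g; apply: cofreeP. Qed.
Let scaleDl f : {morph cofree_scale^~ f : s t / s + t >-> s + t}.
Proof.
by move=> s t; apply: cofreeP => i r; rewrite /cofree_fun /= mulrDr -cofree_additive.
Qed.
HB.instance Definition _ := GRing.Zmodule_isLmodule.Build R cofree
  scaleA scale1 scaleDr scaleDl.

Lemma cofree_injective : injective_module cofree.
Proof.
move=> A B u f u_inj.
have ext i : exists phi : B -> QZ,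
    additive_fun phi /\ forall a, phi (u a) = cofree_fun (f a) i 1.
  pose G : set (B * QZ) := range (fun a => (u a, cofree_fun (f a) i 1)).
  have [|phi phiD phiG] := @partial_hom_extend B G.
    split.
    - by exists 0 => //; rewrite !linear0.
    - by move=> _ _ [a _ <-] [b _ <-]; exists (a - b) => //; rewrite !linearB.
    - move=> d [a _ [ua <-]]; have -> : a = 0 by apply: u_inj; rewrite linear0.
      by rewrite linear0.
  by exists phi; split=> // a; apply: phiG; exists a.
have {ext} [phi phiP] := choice ext.
have gD b i : additive_fun (fun r => phi i (r *: b)).
  by move=> x y; rewrite scalerDl (phiP i).1.
pose g b := Cofree (gD b).
have gL : linear g.
  move=> r x y; apply: cofreeP => i s.
  rewrite /cofree_fun /= scalerDr (phiP i).1 scalerA.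
  by rewrite /GRing.add /= /cofree_add /cofree_fun.
pose gl := HB.pack_for {linear B -> cofree} g
  (GRing.isLinear.Build R B cofree *:%R g gL).
exists gl => a.
apply: cofreeP => i r; rewrite /cofree_fun /=.
by rewrite -linearZ_LR (phiP i).2 linearZ_LR /= /cofree_fun /= mul1r.
Qed.

End Cofree.

Section Resolution.
Variable R : comPzRingType.

Section Step.
Variables (E : lmodType R) (N : submod E).

Definition character_killing : Type :=
  {phi : E -> QZ | additive_fun phi /\ forall x, submod_set N x -> phi x = 0}.

Let map_subproof (x : E) (phi : character_killing) :
  additive_fun (fun r : R => sval phi (r *: x)).
Proof. by move=> r s; rewrite scalerDl (svalP phi).1. Qed.

Definition cofree_map (x : E) : cofree R character_killing :=
  Cofree (map_subproof x).

Lemma cofree_map_linear : linear cofree_map.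
Proof.
move=> r x y; apply: cofreeP => phi s.
rewrite {1}/cofree_fun /= scalerDr (svalP phi).1 scalerA.
by rewrite /GRing.add /= /cofree_add /cofree_fun.
Qed.
HB.instance Definition _ := GRing.isLinear.Build R E
  (cofree R character_killing) *:%R cofree_map cofree_map_linear.

Lemma cofree_map_ker : [set x | cofree_map x = 0] = N.
Proof.
case: (submodP N) => N0 ND NZ; apply/seteqP; split=> [x /= x0|x Nx].
  apply: contrapT => Nx; have [|phi [phiD phiN]] := character_separates N0 _ Nx.
    by move=> y z Ny Nz; apply: ND => //; rewrite -scaleN1r; apply: NZ.
  apply; pose psi : character_killing := exist _ phi (conj phiD phiN).
  have := congr1 (fun f => cofree_fun f psi 1) x0.
  by rewrite /cofree_fun /= scale1r.
by apply: cofreeP => phi r; rewrite /cofree_fun /= (svalP phi).2 //; exact: NZ.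
Qed.

End Step.

Definition resolution_state := {E : lmodType R & submod E}.

Definition resolution_next (S : resolution_state) : resolution_state :=
  existT _ (cofree R (character_killing (projT2 S)) : lmodType R)
    (imm (cofree_map (projT2 S))).

Lemma submodule_zero (M : lmodType R) : submodule [set (0 : M)].
Proof.
split=> [//|_ _ -> ->|r _ ->] /=; first by rewrite addr0.
by rewrite scaler0.
Qed.

Lemma injective_resolution_of (M : lmodType R) : injective_resolution M.
Proof.
pose S0 : resolution_state := existT _ M (Submod (submodule_zero M)).
pose S n := iter n resolution_next (resolution_next S0).
pose E n : lmodType R := projT1 (S n).
pose d n : {linear E n -> E n.+1} := cofree_map (projT2 (S n)).
pose aug : {linear M -> E 0} := cofree_map (projT2 S0).
apply: (@InjectiveResolution R M E d aug).
- by case=> [|n]; exact: cofree_injective.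
- move=> x y xy; apply/eqP; rewrite -subr_eq0; apply/eqP.
  suff : [set z | aug z = 0] (x - y) by rewrite cofree_map_ker.
  by rewrite /= linearB xy subrr.
- exact: cofree_map_ker.
- by move=> n; exact: cofree_map_ker.
Qed.

End Resolution.

Section LocalCohomology.
Variables (R : comPzRingType) (a : set R) (M : lmodType R).

Section FromResolution.
Variable E : injective_resolution M.

Definition torsion_obj n : lmodType R := subm (torsion a (res_obj E n)).

Definition torsion_diff n : {linear torsion_obj n -> torsion_obj n.+1} :=
  torsion_map a (res_diff E n).

(* The incoming map in degree 0 is the zero map. *)
Definition torsion_cohomology (i : nat) : lmodType R :=
  if i is k.+1 then homology (torsion_diff k) (torsion_diff k.+1)
  else homology (\0 : {linear torsion_obj 0 -> torsion_obj 0}) (torsion_diff 0).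

End FromResolution.

(* The right derived functors of the [a]-torsion functor, computed on a fixed
   injective resolution of [M]. *)
Definition local_cohomology : nat -> lmodType R :=
  torsion_cohomology (injective_resolution_of M).

Definition cd : \bar int :=
  supremum -oo%E
    [set (i%:Z)%:E | i in [set i | exists h : local_cohomology i, h <> 0]].

Definition same_radical (J : set R) : Prop :=
  radical_mod (annihilator M) J = radical_mod (annihilator M) a.

Definition ara : \bar int :=
  infimum +oo%E
    [set (n%:Z)%:E |
      n in [set n | exists2 s : seq R, size s = n & same_radical (ideal_gen s)]].

Definition sop (s : seq R) : Prop :=
  [/\ ((size s)%:Z)%:E = cd, [set` s] `<=` a & same_radical (ideal_gen s)].

Definition colon (N : set M) (S : set R) : set M :=
  [set m | forall r, S r -> N (r *: m)].

(* The index is shifted: here [x_(i+1)] is [s`_i]. *)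
Definition weak_sequence (s : seq R) : Prop :=
  forall i, (i < size s)%N ->
    let N := smul (ideal_gen (take i s)) [set: M] in
    colon N [set s`_i] `<=` colon N a.

Definition quasi_buchsbaum : Prop :=
  cd = ara /\
  forall s : seq R, sop s -> [set` s] `<=` ideal_pow a 2 -> weak_sequence s.

End LocalCohomology.

Arguments local_cohomology {R} a M i.

(* Main.v *)
(* The functors H^i_a are the iterated right satellites
   S T (A) = coker (T (E) -> T (E / A)), with A in an injective module E, of the
   torsion functor. For a half exact T the connecting map T (C) -> S T (A) of
   0 -> A -> B -> C -> 0 comes from an extension B -> E of A -> E, the long
   sequence is exact and S T is half exact again. Over a Noetherian ring the
   torsion submodule of an injective module is injective, so H^i_a vanishes for
   i > 0 on torsion modules.

   (ii) => (iii): if x is the first term of the sequence, T = 0 :_M x is killed by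
   a, so H^i (M) = H^i (M / T) for i > 0, and M / T -> M -> M / x M shows, by
   induction, that a kills the kernel of x on H^i (M). Since x is in a^2 and
   H^i (M) is torsion, a kills H^i (M).

   (iii) => (i): the first term x is filter-regular, i.e. 0 :_M x is torsion, hence
   killed by a. Then a kills H^i (M / x M), because multiplication by x factors
   as M / T -> P -> M with the first map zero on H^(i+1) and the second zero on
   H^i. One concludes by induction on the length.

   Filter-regularity: reduce to M without torsion and let N = 0 :_M x. Prime
   avoidance gives an M-regular y, congruent to the second term modulo the others;
   by induction N / y^t N is torsion for all t. The embedding of the torsion of
   M / y^t M in H^1 (M) bounds it uniformly, whence y^l N = y^(l+1) N for some l,
   N = y N, and N = 0 since y lies in the Jacobson radical. *)

From HB Require Import structures.
From mathcomp Require Import all_boot all_order all_algebra.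
From mathcomp Require Import generic_quotient.
From mathcomp Require Import boolp classical_sets constructive_ereal.
Require Import Defs.

Set Implicit Arguments.
Unset Strict Implicit.
Unset Printing Implicit Defensive.

Import Order.TTheory GRing.Theory Num.Theory.
Local Open Scope classical_set_scope.
Local Open Scope ring_scope.
Local Open Scope quotient_scope.

(** * Linear maps and short exact sequences *)

(* Locked, so that simplification keeps [linearD] and the like applicable. *)
HB.lock Definition linear_of (R : comPzRingType) (A B : lmodType R) (f : A -> B)
    (fL : linear f) : {linear A -> B} :=
  HB.pack_for {linear A -> B} f (GRing.isLinear.Build R A B *:%R f fL).

Section LinearMaps.
Variable R : comPzRingType.
Implicit Types A B C D E M W : lmodType R.

Lemma linear_ofE A B (f : A -> B) (fL : linear f) x : linear_of fL x = f x.
Proof. by rewrite linear_of.unlock. Qed.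

Lemma homothety_linear M (r : R) : linear (fun x : M => r *: x).
Proof. by move=> s x y; rewrite scalerDr !scalerA mulrC. Qed.

Definition homothety M (r : R) : {linear M -> M} := linear_of (homothety_linear r).

Lemma homothetyE M (r : R) (x : M) : homothety M r x = r *: x.
Proof. exact: linear_ofE. Qed.

Lemma quot_map_linear M (N : submod M) : linear (fun x : M => \pi_(quotm N) x).
Proof. by move=> r x y; rewrite -pi_quotmD -pi_quotmZ. Qed.

Definition quot_map M (N : submod M) : {linear M -> quotm N} :=
  linear_of (quot_map_linear N).

Lemma quot_map_surj M (N : submod M) (y : quotm N) : exists x, quot_map N x = y.
Proof. by exists (repr y); rewrite /quot_map linear_ofE reprK. Qed.

Lemma quot_map_eq0 M (N : submod M) x : quot_map N x = 0 <-> submod_set N x.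
Proof.
rewrite -(linear0 (quot_map N)) /quot_map !linear_ofE.
by split=> [/pi_quotm_eq|Nx]; [|apply/pi_quotm_eq]; rewrite subr0.
Qed.

Lemma factor_surj A B C (p : {linear A -> B}) (f : {linear A -> C}) :
  (forall b, exists a, p a = b) -> (forall a, p a = 0 -> f a = 0) ->
  exists g : {linear B -> C}, forall a, g (p a) = f a.
Proof.
move=> /choice [s sP] kf.
have fs a a' : p a = p a' -> f a = f a'.
  move=> e; apply/eqP; rewrite -subr_eq0 -linearB; apply/eqP/kf.
  by rewrite linearB e subrr.
have gL : linear (fun b => f (s b)).
  by move=> r x y; rewrite -linearP; apply: fs; rewrite linearP !sP.
by exists (linear_of gL) => a; rewrite linear_ofE; apply: fs; rewrite sP.
Qed.

Lemma factor_inj A B C (i : {linear B -> C}) (f : {linear A -> C}) :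
  injective i -> (forall a, exists b, i b = f a) ->
  exists g : {linear A -> B}, forall a, i (g a) = f a.
Proof.
move=> inj_i /choice [g gP].
have gL : linear g by move=> r x y; apply: inj_i; rewrite linearP !gP linearP.
by exists (linear_of gL) => a; rewrite linear_ofE.
Qed.

Lemma linear_inj A B (f : {linear A -> B}) :
  (forall a, f a = 0 -> a = 0) -> injective f.
Proof.
move=> f0 x y e; apply/eqP; rewrite -subr_eq0; apply/eqP/f0.
by rewrite linearB e subrr.
Qed.

(* [X] is the graph of a partially defined linear map. *)
Lemma injective_extend A E (X : submod (A * E)%type) : injective_module E ->
  (forall e, submod_set X (0, e) -> e = 0) ->
  exists g : {linear A -> E}, forall a e, submod_set X (a, e) -> g a = e.
Proof.
move=> injE X0.
have fL : linear (fun x : subm X => (val x).1) by move=> r x y; rewrite !linearP.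
have gL : linear (fun x : subm X => (val x).2) by move=> r x y; rewrite !linearP.
have [|g gP] := injE _ _ (linear_of fL) (linear_of gL).
  apply: linear_inj => -[[a e] /= Xae] a0; apply: val_inj => /=.
  have {}a0 : a = 0 by move: a0; rewrite linear_ofE.
  by move/asboolP: Xae; rewrite a0 => /X0 ->.
exists g => a e Xae; have Xb : mem_submod X (a, e) by apply/asboolP.
by have := gP (Sub (a, e) Xb); rewrite !linear_ofE.
Qed.

Record short_exact A B C (i : {linear A -> B}) (p : {linear B -> C}) : Prop :=
  ShortExact {
    se_inj : injective i;
    se_ker : forall b, p b = 0 <-> exists a, i a = b;
    se_surj : forall c, exists b, p b = c }.

Lemma se_comp0 A B C (i : {linear A -> B}) (p : {linear B -> C}) a :
  short_exact i p -> p (i a) = 0.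
Proof. by move=> s; apply/(se_ker s); exists a. Qed.

Lemma short_exact_quot A B (i : {linear A -> B}) :
  injective i -> short_exact i (quot_map (imm i)).
Proof.
move=> inj_i; split=> // [b|c]; last exact: quot_map_surj.
rewrite quot_map_eq0; split=> [[a _ <-]|[a <-]]; by exists a.
Qed.

(** With [A] inside [B] inside [E], this is the third isomorphism theorem for [C = B / A],
    [W = E / A] and [D = E / B]. It is applied with [E = env B]. *)
Lemma short_exact_third A B C D E W (i : {linear A -> B}) (p : {linear B -> C})
    (e : {linear B -> E}) (d : {linear E -> D}) (q : {linear E -> W}) :
  short_exact i p -> short_exact e d -> short_exact (e \o i) q ->
  exists (j : {linear C -> W}) (g : {linear W -> D}),
    [/\ short_exact j g, forall b, j (p b) = q (e b) & forall x, g (q x) = d x].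
Proof.
move=> se seD seW.
have [|g gq] := factor_surj (p := q) (f := d) (se_surj seW).
  by move=> x /(se_ker seW) [a <-]; exact: se_comp0 seD.
have [|j jp] := factor_surj (p := p) (f := q \o e) (se_surj se).
  by move=> x /(se_ker se) [a <-]; exact: (se_comp0 _ seW).
exists j, g; split=> //; split=> [|w|x].
- apply: linear_inj => c; have [b <-] := se_surj se c; rewrite jp.
  by move=> /(se_ker seW) [a /(se_inj seD) <-]; exact: se_comp0 se.
- have [x <-] := se_surj seW w; rewrite gq; split.
    by move=> /(se_ker seD) [b <-]; exists (p b); rewrite jp.
  case=> c; have [b <-] := se_surj se c; rewrite jp /= => jb.
  by rewrite -gq -jb gq; exact: se_comp0 seD.
- by have [y <-] := se_surj seD x; exists (q y); rewrite gq.
Qed.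

End LinearMaps.

(** * Right satellites of half exact functors *)

Section Satellites.
Variable R : comPzRingType.
Implicit Types A B C X Y : lmodType R.

(** The laws take pointwise equations as premises, so that equality of bundled linear maps never has
    to be proved. At [r = 1], [fmap_scale] is the identity law. *)
Record half_exact_functor := HalfExactFunctor {
  fobj :> lmodType R -> lmodType R;
  fmap : forall A B, {linear A -> B} -> {linear fobj A -> fobj B};
  fmap_comp : forall A B C
    (f : {linear A -> B}) (g : {linear B -> C}) (h : {linear A -> C}),
    (forall x, h x = g (f x)) -> forall u, fmap h u = fmap g (fmap f u);
  fmap_add : forall A B (f g h : {linear A -> B}),
    (forall x, h x = f x + g x) -> forall u, fmap h u = fmap f u + fmap g u;
  fmap_scale : forall A (r : R) (f : {linear A -> A}),
    (forall x, f x = r *: x) -> forall u, fmap f u = r *: u;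
  fmap_exact : forall A B C (i : {linear A -> B}) (p : {linear B -> C}),
    short_exact i p -> forall u, fmap p u = 0 -> exists v, fmap i v = u }.

Arguments fmap _ {A B} f.
Arguments fmap_comp _ {A B C} [f g h].
Arguments fmap_add _ {A B} [f g h].

Definition env A : lmodType R := res_obj (injective_resolution_of A) 0.
Definition env_in A : {linear A -> env A} := res_aug (injective_resolution_of A).
Definition cok A : lmodType R := quotm (imm (env_in A)).
Definition cok_map A : {linear env A -> cok A} := quot_map (imm (env_in A)).

Lemma env_injective A : injective_module (env A).
Proof. exact: res_injective. Qed.

Lemma short_exact_env A : short_exact (env_in A) (cok_map A).
Proof. exact/short_exact_quot/res_aug_inj. Qed.

(** [e] induces [c] on quotients. The same relation describes lifts of maps and the maps behind
    connecting homomorphisms, so that [satcls_covers] settles independence of choices for both. *)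
Definition covers Y X B (q : {linear Y -> X}) (c : {linear X -> cok B})
  (e : {linear Y -> env B}) : Prop := forall y, c (q y) = cok_map B (e y).

Lemma covers_exist A Y X B (i : {linear A -> Y}) (q : {linear Y -> X})
    (f : {linear A -> B}) : short_exact i q ->
  exists c e, covers q c e /\ forall a, e (i a) = env_in B (f a).
Proof.
move=> s.
have [e eP] := @env_injective B _ _ i (env_in B \o f) (se_inj s).
have [y /(se_ker s) [a <-]|c cP] := factor_surj (f := cok_map B \o e) (se_surj s).
  by rewrite /= eP; exact: se_comp0 (short_exact_env B).
by exists c, e; split=> // a; rewrite eP.
Qed.

Section Satellite.
Variable T : half_exact_functor.

Lemma fmap_id A (f : {linear A -> A}) :
  (forall x, f x = x) -> forall u, fmap T f u = u.
Proof. by move=> fx u; rewrite (fmap_scale (r := 1)) ?scale1r // => x; rewrite scale1r. Qed.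

Lemma fmap0 A B (f : {linear A -> B}) :
  (forall x, f x = 0) -> forall u, fmap T f u = 0.
Proof.
move=> f0 u; apply: (addIr (fmap T f u)).
by rewrite add0r -(fmap_add T (h := f)) // => x; rewrite f0 addr0.
Qed.

Lemma fmap_sub A B (f g h : {linear A -> B}) :
  (forall x, h x = f x - g x) -> forall u, fmap T h u = fmap T f u - fmap T g u.
Proof.
move=> hE u; apply: (addIr (fmap T g u)); rewrite subrK -(fmap_add T (h := f)) //.
by move=> x; rewrite hE subrK.
Qed.

Definition satm A : lmodType R := quotm (imm (fmap T (cok_map A))).
Definition satcls A : {linear T (cok A) -> satm A} :=
  quot_map (imm (fmap T (cok_map A))).

Lemma satcls_surj A (h : satm A) : exists u, satcls A u = h.
Proof. exact: quot_map_surj. Qed.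

Lemma satcls_eq0 A u : satcls A u = 0 <-> exists e, fmap T (cok_map A) e = u.
Proof. by rewrite quot_map_eq0; split=> [[e _ <-]|[e <-]]; exists e. Qed.

(** The difference [e1 - e2] kills the kernel of [q], so it descends to [d : X -> env B]. Then
    [c1 - c2] is [d] followed by [cok_map B], and [T] sends it into the image that [satcls]
    kills. *)
Lemma satcls_covers Y X B (q : {linear Y -> X}) (c1 c2 : {linear X -> cok B})
    (e1 e2 : {linear Y -> env B}) :
  (forall x, exists y, q y = x) -> covers q c1 e1 -> covers q c2 e2 ->
  (forall y, q y = 0 -> e1 y = e2 y) ->
  forall w, satcls B (fmap T c1 w) = satcls B (fmap T c2 w).
Proof.
move=> q_surj c1P c2P e12 w.
have [y /e12 e|d dP] := factor_surj (f := e1 \- e2) q_surj.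
  by rewrite /= e subrr.
apply/eqP; rewrite -subr_eq0 -linearB; apply/eqP/satcls_eq0; exists (fmap T d w).
rewrite -(fmap_sub (h := c1 \- c2)) //; apply/esym.
apply: (fmap_comp T) => x; have [y <-] := q_surj x.
by rewrite dP /= c1P c2P linearB.
Qed.

Definition lifts A B (f : {linear A -> B}) (c : {linear cok A -> cok B}) :=
  exists2 e, covers (cok_map A) c e & forall a, e (env_in A a) = env_in B (f a).

Lemma lifts_exist A B (f : {linear A -> B}) : exists c, lifts f c.
Proof.
have [c [e [ce ef]]] := covers_exist f (short_exact_env A).
by exists c, e.
Qed.

(** The formula is asserted for all lifts at once, so that later arguments may use whichever lift is
    convenient. *)
Lemma satm_map_exists A B (f : {linear A -> B}) :
  exists g : {linear satm A -> satm B},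
    forall c, lifts f c -> forall u, g (satcls A u) = satcls B (fmap T c u).
Proof.
have [c0 [e0 ce0 ef0]] := lifts_exist f.
have [u /satcls_eq0 [e <-]|g gP] :=
    factor_surj (f := satcls B \o fmap T c0) (@satcls_surj A).
  rewrite /= -(fmap_comp T (h := c0 \o cok_map A)) //.
  by apply/satcls_eq0; exists (fmap T e0 e); rewrite -(fmap_comp T (h := c0 \o cok_map A)).
exists g => c [e ce ef] u; rewrite gP /=.
apply: (satcls_covers _ ce0 ce); first exact: se_surj (short_exact_env A).
by move=> y /(se_ker (short_exact_env A)) [a <-]; rewrite ef ef0.
Qed.

Definition satm_map A B (f : {linear A -> B}) := sval (cid (satm_map_exists f)).

Lemma satm_mapE A B (f : {linear A -> B}) c : lifts f c ->
  forall u, satm_map f (satcls A u) = satcls B (fmap T c u).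
Proof. exact: (svalP (cid (satm_map_exists f))). Qed.

Lemma satm_map_comp A B C
    (f : {linear A -> B}) (g : {linear B -> C}) (h : {linear A -> C}) :
  (forall x, h x = g (f x)) -> forall u, satm_map h u = satm_map g (satm_map f u).
Proof.
move=> hE u; have [w <-] := satcls_surj u.
have [c [e ce ef]] := lifts_exist f; have [d [e' de' eg]] := lifts_exist g.
rewrite !(@satm_mapE _ _ f c) ?(@satm_mapE _ _ g d) ?(@satm_mapE _ _ h (d \o c)).
- by rewrite (fmap_comp T (h := d \o c) (f := c) (g := d)).
- exists (e' \o e) => x /=; first by rewrite ce de'.
  by rewrite ef eg hE.
- by exists e'.
- by exists e.
Qed.

Lemma satm_map_add A B (f g h : {linear A -> B}) :
  (forall x, h x = f x + g x) ->
  forall u, satm_map h u = satm_map f u + satm_map g u.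
Proof.
move=> hE u; have [w <-] := satcls_surj u.
have [c [e ce ef]] := lifts_exist f; have [d [e' de' eg]] := lifts_exist g.
rewrite (@satm_mapE _ _ f c) ?(@satm_mapE _ _ g d) ?(@satm_mapE _ _ h (c \+ d)).
- by rewrite (fmap_add T (h := c \+ d) (f := c) (g := d)) // linearD.
- exists (e \+ e') => x /=; first by rewrite ce de' linearD.
  by rewrite ef eg hE linearD.
- by exists e'.
- by exists e.
Qed.

Lemma satm_map_scale A (r : R) (f : {linear A -> A}) :
  (forall x, f x = r *: x) -> forall u, satm_map f u = r *: u.
Proof.
move=> fE u; have [w <-] := satcls_surj u.
rewrite (@satm_mapE _ _ f (homothety _ r)).
  by rewrite (fmap_scale (r := r)) ?linearZ_LR // => x; rewrite homothetyE.
exists (homothety _ r) => x; rewrite ?homothetyE; first by rewrite linearZ_LR.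
by rewrite fE linearZ_LR.
Qed.

(** * Connecting maps and the exactness of the long sequence *)

Section Connecting.
Variables (A B C : lmodType R) (i : {linear A -> B}) (p : {linear B -> C}).
Hypothesis se : short_exact i p.

Definition connects (c : {linear C -> cok A}) :=
  exists2 k, covers p c k & forall a, k (i a) = env_in A a.

Lemma connects_exist : exists c, connects c.
Proof.
(* [homothety A 1] serves as the identity of [A], here and below. *)
have [c [e [ce ei]]] := covers_exist (homothety A 1) se.
by exists c, e => // a; rewrite ei homothetyE scale1r.
Qed.

Lemma connecting_exists : exists d : {linear T C -> satm A},
  forall c, connects c -> forall u, d u = satcls A (fmap T c u).
Proof.
have [c0 [e0 ce0 ei0]] := connects_exist.
exists (satcls A \o fmap T c0) => c [e ce ei] u /=.
apply: (satcls_covers _ ce0 ce); first exact: se_surj se.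
by move=> y /(se_ker se) [a <-]; rewrite ei ei0.
Qed.

Definition connecting := sval (cid connecting_exists).

Lemma connectingE c : connects c ->
  forall u, connecting u = satcls A (fmap T c u).
Proof. exact: (svalP (cid connecting_exists)). Qed.

Lemma connecting_fmap u : connecting (fmap T p u) = 0.
Proof.
have [c cc] := connects_exist; rewrite (connectingE cc).
case: cc => k ck ki; apply/satcls_eq0; exists (fmap T k u).
by rewrite -!(fmap_comp T (h := c \o p)).
Qed.

(** [B] is the fibre product of [env A] and [C] over [cok A], whence a short exact sequence from [B]
    through [env A * C] to [cok A]. The pair made of [e] and [u] dies in [T (cok A)], so it lifts to
    [T B], and projecting to [C] recovers [u]. *)
Lemma connecting_eq0 u : connecting u = 0 -> exists v, fmap T p v = u.
Proof.
have [c cc] := connects_exist; rewrite (connectingE cc) => /satcls_eq0 [e eu].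
case: cc => k ck ki.
have jL : linear (fun b => (k b, p b)) by move=> r x y; rewrite !linearP.
pose sm : {linear (env A * C)%type -> cok A} := (cok_map A \o fst) \- (c \o snd).
have i1L : linear (fun x => (x, 0) : env A * C).
  by move=> r x y; congr pair; rewrite /= scaler0 addr0.
have i2L : linear (fun x => (0, x) : env A * C).
  by move=> r x y; congr pair; rewrite /= scaler0 addr0.
have se' : short_exact (linear_of jL) sm.
  split=> [|[x z]|c0].
  - apply: linear_inj => b; rewrite linear_ofE => -[kb /(se_ker se) [a ab]].
    move: kb; rewrite -ab ki -(linear0 (env_in A)).
    by move/(se_inj (short_exact_env A)) ->; rewrite linear0.
  - rewrite /sm /=; split=> [|[b]]; last by rewrite linear_ofE => -[<- <-]; rewrite ck subrr.
    have [b <-] := se_surj se z; rewrite ck -linearB.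
    move/(se_ker (short_exact_env A)) => [a aE].
    exists (b + i a); rewrite linear_ofE !linearD ki aE (se_comp0 _ se) addr0.
    by rewrite addrC subrK.
  - have [x <-] := se_surj (short_exact_env A) c0; exists (x, 0).
    by rewrite /sm /= linear0 subr0.
pose w := fmap T (linear_of i1L) e + fmap T (linear_of i2L) u.
have [|b bw] := fmap_exact se' (u := w).
  rewrite linearD -(fmap_comp T (h := cok_map A)); last first.
    by move=> x; rewrite /sm linear_ofE /= linear0 subr0.
  rewrite -(fmap_comp T (h := \- c)); last by move=> x; rewrite /sm linear_ofE /= linear0 sub0r.
  rewrite eu -(fmap_add T (h := \0)); last by move=> x; rewrite /= subrr.
  exact: fmap0.
exists b; rewrite (fmap_comp T (f := linear_of jL) (g := snd)); last first.
  by move=> x; rewrite linear_ofE.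
rewrite bw linearD -(fmap_comp T (h := \0)); last by move=> x; rewrite linear_ofE.
rewrite -(fmap_comp T (h := idfun)); last by move=> x; rewrite linear_ofE.
by rewrite fmap0 // fmap_id // add0r.
Qed.

(** Let [W = env B / A]. The image of [u] in [T W], corrected by [e] from [T (env B)], dies in
    [T (cok B)], so it comes from some [c] in [T C]. A map [g : W -> cok A] covered by
    [l : env B -> env A] carries this back: the correction becomes zero in the satellite, and the
    rest has the class of [u], since [l \o ei] and the identity agree on [A]. *)
Lemma satm_map_eq0 h : satm_map i h = 0 -> exists u, connecting u = h.
Proof.
have [u <-] := satcls_surj h; have [ci cil] := lifts_exist i.
case: (cil) => ei cie eii; rewrite (satm_mapE cil) => /satcls_eq0 [e eu].
have inj_j : injective (env_in B \o i).
  exact: inj_comp (se_inj (short_exact_env B)) (se_inj se).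
have seW := short_exact_quot inj_j.
have [g [l [gl li]]] := covers_exist (homothety A 1) seW.
set q := quot_map _ in gl seW.
have [|f fq] := factor_surj (p := cok_map A) (f := q \o ei) (se_surj (short_exact_env A)).
  move=> x /(se_ker (short_exact_env A)) [a <-] /=; rewrite eii.
  exact: (se_comp0 _ seW).
have [j [g' [se' jp g'q]]] := short_exact_third se (short_exact_env B) seW.
have [|c cE] := fmap_exact se' (u := fmap T f u - fmap T q e).
  rewrite linearB -(fmap_comp T (h := ci)); last first.
    move=> x; have [y <-] := se_surj (short_exact_env A) x.
    by rewrite cie fq /= g'q.
  by rewrite -(fmap_comp T (h := cok_map B)) // eu subrr.
have gj : connects (g \o j).
  exists (l \o env_in B) => [b|a]; first by rewrite /= jp /= gl.
  by rewrite /= (li a) homothetyE scale1r.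
exists c; rewrite (connectingE gj) (fmap_comp T (f := j) (g := g)) // cE.
rewrite linearB -!(fmap_comp T (h := g \o q)) // linearB -(fmap_comp T (h := g \o f)) //.
have -> : satcls A (fmap T (g \o q) e) = 0.
  by apply/satcls_eq0; exists (fmap T l e); rewrite -(fmap_comp T (h := g \o q)).
rewrite subr0 -[in RHS](@fmap_id _ idfun _ u) //.
apply: (@satcls_covers _ _ _ (cok_map A) _ _ (l \o ei) idfun).
- exact: se_surj (short_exact_env A).
- by move=> y; rewrite /= fq /= gl.
- by [].
- move=> y /(se_ker (short_exact_env A)) [a <-] /=.
  by rewrite eii (li a) homothetyE scale1r.
Qed.

End Connecting.

(** A connecting map for [C -> W -> cok B], with [W = env B / A], is also a lift of [p]. So a class
    killed by [p] comes from [T W], and pushing it along [g : W -> cok A] gives the preimage. *)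
Lemma satm_map_exact A B C (i : {linear A -> B}) (p : {linear B -> C}) :
  short_exact i p -> forall h, satm_map p h = 0 -> exists u, satm_map i u = h.
Proof.
move=> se h; have [w <-] := satcls_surj h.
have inj_j : injective (env_in B \o i).
  exact: inj_comp (se_inj (short_exact_env B)) (se_inj se).
have seW := short_exact_quot inj_j.
have [g [l [gl li]]] := covers_exist (homothety A 1) seW.
have [j [g' [se' jp g'q]]] := short_exact_third se (short_exact_env B) seW.
set q := quot_map _ in seW gl jp g'q.
have [c' cc'] := connects_exist se'.
have lc' : lifts p c'.
  case: cc' => k ck kj; exists (k \o q) => [x|b] /=; first by rewrite -g'q ck.
  by rewrite -jp kj.
rewrite (satm_mapE lc') -(connectingE se' cc') => /connecting_eq0 [w' <-].
exists (satcls A (fmap T g w')).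
have [ci cil] := lifts_exist i; rewrite (satm_mapE cil).
rewrite -(fmap_comp T (h := ci \o g)) //; case: cil => ei cie eii.
apply: (@satcls_covers _ _ _ q _ _ (ei \o l) idfun).
- exact: se_surj seW.
- by move=> y; rewrite /= gl cie.
- by move=> y; rewrite g'q.
- move=> y /(se_ker seW) [a <-] /=.
  by rewrite (li a) homothetyE scale1r eii.
Qed.


Lemma connecting_natural A B C A' B' C'
    (i : {linear A -> B}) (p : {linear B -> C}) (se : short_exact i p)
    (i' : {linear A' -> B'}) (p' : {linear B' -> C'}) (se' : short_exact i' p')
    (f : {linear A -> A'}) (g : {linear B -> B'}) (h : {linear C -> C'}) :
  (forall a, g (i a) = i' (f a)) -> (forall b, h (p b) = p' (g b)) ->
  forall u, satm_map f (connecting se u) = connecting se' (fmap T h u).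
Proof.
move=> gi hp u; have [c cc] := connects_exist se; have [c' cc'] := connects_exist se'.
have [d dd] := lifts_exist f.
rewrite (connectingE se cc) (connectingE se' cc') (satm_mapE dd).
rewrite -(fmap_comp T (h := d \o c)) // -(fmap_comp T (h := c' \o h)) //.
case: cc cc' dd => [k ck ki] [k' ck' ki'] [e de ef].
apply: (@satcls_covers _ _ _ p _ _ (e \o k) (k' \o g)).
- exact: se_surj se.
- by move=> y; rewrite /= ck de.
- by move=> y; rewrite /= hp ck'.
- by move=> y /(se_ker se) [a <-] /=; rewrite ki ef gi ki'.
Qed.

(** A retraction [r] of [env_in B] makes [cok_map B] split, so that [T] keeps it surjective. *)
Lemma satm_injective B : injective_module B -> forall h : satm B, h = 0.
Proof.
move=> injB h; have [w <-] := satcls_surj h.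
have [r rP] := injB _ _ (env_in B) idfun (se_inj (short_exact_env B)).
have [|s sP] := factor_surj (p := cok_map B) (f := idfun \- (env_in B \o r))
    (se_surj (short_exact_env B)).
  by move=> x /(se_ker (short_exact_env B)) [b <-]; rewrite /= rP /= subrr.
apply/satcls_eq0; exists (fmap T s w); rewrite -(fmap_comp T (h := idfun)) ?fmap_id //.
move=> x; have [y <-] := se_surj (short_exact_env B) x.
by rewrite sP /= linearB (se_comp0 _ (short_exact_env B)) subr0.
Qed.

Definition satellite : half_exact_functor := HalfExactFunctor
  satm_map_comp satm_map_add satm_map_scale satm_map_exact.

End Satellite.
End Satellites.

(** * Local cohomology as a sequence of satellites *)

Section LocalCohomologyFunctor.
Variables (R : comPzRingType) (a : set R).
Implicit Types A B C M X : lmodType R.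

Definition is_torsion M (x : M) : Prop := exists n, forall r, ideal_pow a n r -> r *: x = 0.

Let tmap A B (f : {linear A -> B}) :
  {linear subm (torsion a A) -> subm (torsion a B)} := torsion_map a f.

Let tmap_comp A B C (f : {linear A -> B}) (g : {linear B -> C}) (h : {linear A -> C}) :
  (forall x, h x = g (f x)) -> forall u, tmap h u = tmap g (tmap f u).
Proof. by move=> hE u; apply: val_inj; rewrite /= hE. Qed.

Let tmap_add A B (f g h : {linear A -> B}) :
  (forall x, h x = f x + g x) -> forall u, tmap h u = tmap f u + tmap g u.
Proof. by move=> hE u; apply: val_inj; rewrite /= hE. Qed.

Let tmap_scale A (r : R) (f : {linear A -> A}) :
  (forall x, f x = r *: x) -> forall u, tmap f u = r *: u.
Proof. by move=> fE u; apply: val_inj; rewrite /= fE. Qed.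

Lemma torsion_inj A B (i : {linear A -> B}) x :
  injective i -> is_torsion (i x) -> is_torsion x.
Proof.
move=> inj_i [n xn]; exists n => r ar; apply: inj_i.
by rewrite linearZ_LR xn // linear0.
Qed.

Lemma torsion_linear A B (f : {linear A -> B}) x : is_torsion x -> is_torsion (f x).
Proof. by case=> n xn; exists n => r ar; rewrite -linearZ_LR xn // linear0. Qed.

Lemma submP M (x : subm (torsion a M)) : is_torsion (val x).
Proof. by case: x => x /= /asboolP. Qed.

Lemma subm_lift M (x : M) : is_torsion x -> exists u : subm (torsion a M), val u = x.
Proof. by move=> /asboolP xt; exists (Sub x xt). Qed.

Let tmap_exact A B C (i : {linear A -> B}) (p : {linear B -> C}) :
  short_exact i p -> forall u, tmap p u = 0 -> exists v, tmap i v = u.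
Proof.
move=> se u /(congr1 val) /= /(se_ker se) [x xu].
have [|v vx] := @subm_lift A x.
  by apply: (torsion_inj (se_inj se)); rewrite xu; exact: submP.
by exists v; apply: val_inj; rewrite /= vx.
Qed.

Definition torsion_functor : half_exact_functor R :=
  HalfExactFunctor tmap_comp tmap_add tmap_scale tmap_exact.

Definition lc (n : nat) : half_exact_functor R := iter n (@satellite R) torsion_functor.

Lemma lc_torsion n M (h : lc n M) : is_torsion h.
Proof.
elim: n M h => [|n IH] M h.
  by case: (submP h) => n hn; exists n => r ar; apply: val_inj; rewrite /= hn.
have [u <-] := satcls_surj h; exact/torsion_linear/IH.
Qed.

Lemma lc_injective n B : injective_module B -> forall h : lc n.+1 B, h = 0.
Proof. exact: satm_injective. Qed.

Definition kills (r : R) M := forall h : M, r *: h = 0.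

(** As the satellite vanishes on the injective [B], [satellite T A] is the cokernel of
    [T B -> T C]. *)
Lemma kills_satellite (T : half_exact_functor R) (r : R) A B C
    (i : {linear A -> B}) (p : {linear B -> C}) :
  short_exact i p -> injective_module B ->
  kills r (satellite T A) <-> forall u : T C, exists v, fmap T p v = r *: u.
Proof.
move=> se injB; split=> [rA u|rC h].
  by apply: (@connecting_eq0 _ T _ _ _ _ _ se); rewrite linearZ_LR rA.
have [|u <-] := satm_map_eq0 se (h := h); first exact: satm_injective.
by have [v uv] := rC u; rewrite -linearZ_LR -uv connecting_fmap.
Qed.

Lemma kills_lcS n (r : R) A B C (i : {linear A -> B}) (p : {linear B -> C}) :
  short_exact i p -> injective_module B ->
  kills r (lc n.+2 A) <-> kills r (lc n.+1 C).
Proof.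
move=> se injB; rewrite [X in X <-> _](kills_satellite (lc n.+1) r se injB).
split=> [rC u|rC u]; last by exists 0; rewrite rC linear0.
by have [v <-] := rC u; rewrite (lc_injective injB v) linear0.
Qed.

(** * Comparison of the satellites with an injective resolution *)

Section Resolution.
Variables (M : lmodType R) (E : injective_resolution M) (r : R).

Let cocycles n : lmodType R := subm (kerm (res_diff E n)).

Let cocycleP n (z : cocycles n) : res_diff E n (val z) = 0.
Proof. by case: z => z /= /asboolP. Qed.

Let diff_sq n x : res_diff E n.+1 (res_diff E n x) = 0.
Proof.
suff : [set y | res_diff E n.+1 y = 0] (res_diff E n x) by [].
by rewrite res_exactS; exists x.
Qed.

Let syzygy_step n X (i : {linear X -> res_obj E n}) : injective i ->
    [set x | res_diff E n x = 0] = range i ->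
  exists d : {linear res_obj E n -> cocycles n.+1},
    short_exact i d /\ forall x, val (d x) = res_diff E n x.
Proof.
move=> inj_i ker_i.
have [|d dP] := @factor_inj R (res_obj E n) (cocycles n.+1) _ val (res_diff E n) val_inj.
  move=> x; have xP : mem_submod (kerm (res_diff E n.+1)) (res_diff E n x).
    exact/asboolP/diff_sq.
  by exists (Sub _ xP).
exists d; split=> //; split=> // [x|z].
  have -> : d x = 0 <-> [set x | res_diff E n x = 0] x.
    by rewrite /= -dP; split=> [->|d0] //; apply: val_inj.
  by rewrite ker_i; split=> [[y _ <-]|[y <-]]; exists y.
have : [set y | res_diff E n.+1 y = 0] (val z) by exact: cocycleP.
by rewrite res_exactS => -[x _ xz]; exists x; apply: val_inj; rewrite dP.
Qed.

(** On elements: [r] kills the cohomology of the torsion complex in degree [n.+1]. *)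
Let kills_torsion_at n := forall z : res_obj E n.+1,
  res_diff E n.+1 z = 0 -> is_torsion z ->
  exists2 e, is_torsion e & res_diff E n e = r *: z.

(** Dimension shifting: each step replaces [X] by the cocycles in degree [n.+1]. Stating it for any
    kernel [X] lets the induction start at [M] and continue with cocycles. *)
Let kills_syzygy k n X (i : {linear X -> res_obj E n}) : injective i ->
  [set x | res_diff E n x = 0] = range i ->
  kills r (lc k.+1 X) <-> kills_torsion_at (n + k)%N.
Proof.
elim: k n X i => [|k IH] n X i inj_i ker_i;
  have [d [se dE]] := syzygy_step inj_i ker_i; have injE := @res_injective _ _ E n.
  rewrite [X in X <-> _](kills_satellite (lc 0) r se injE) addn0; split=> H.
  - move=> z z0 zt; have zP : mem_submod (kerm (res_diff E n.+1)) z by exact/asboolP.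
    have [|u uz] := @subm_lift (cocycles n.+1) (Sub z zP).
      case: zt => k zk; exists k => s sk; apply: val_inj; exact: zk.
    have [v vu] := H u; exists (val v); first exact: submP.
    have := congr1 (fun x => val (val x)) vu; rewrite /= dE => ->.
    by rewrite uz.
  - move=> u; have [|e et ez] := H _ (cocycleP (val u)).
      exact: (torsion_linear _ (submP u)).
    have [v ve] := subm_lift et; exists v; apply/val_inj/val_inj => /=.
    by rewrite dE ve.
rewrite (kills_lcS k r se injE) (IH _ _ (val : {linear cocycles n.+1 -> _}));
  [by rewrite addSnnS|exact: val_inj|].
apply/seteqP; split=> [x x0|_ [x _ <-]]; last exact: cocycleP.
have xP : mem_submod (kerm (res_diff E n.+1)) x by exact/asboolP.
by exists (Sub x xP).
Qed.

(** The theorem only asks which elements annihilate local cohomology, so this equivalence replaces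
    an isomorphism between the two constructions. *)
Lemma kills_torsion_cohomology n :
  kills r (torsion_cohomology a E n) <-> kills r (lc n M).
Proof.
case: n => [|n].
  split=> H.
  - move=> m; apply: val_inj => /=; apply: (@res_aug_inj _ _ E); rewrite linear0 linearZ_LR.
    have d0 : res_diff E 0 (res_aug E (val m)) = 0.
      suff : [set x | res_diff E 0 x = 0] (res_aug E (val m)) by [].
      by rewrite res_exact0; exists (val m).
    have [u uE] := subm_lift (torsion_linear (res_aug E) (submP m)).
    have uP : mem_submod (kerm (torsion_diff a E 0)) u.
      by apply/asboolP; apply: val_inj; rewrite /= uE.
    have {}H := H (quot_map _ (Sub u uP)); rewrite -linearZ_LR in H.
  have [v _] := proj1 (quot_map_eq0 _ _) H.
    by rewrite -uE => /(congr1 val) /= <-.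
  - move=> h; have [z <-] := quot_map_surj h; rewrite -linearZ_LR; apply/quot_map_eq0.
    (* The incoming map is zero, so [r z] itself must vanish; this holds since [z] comes from a
       torsion element of [M]. *)
    exists 0 => //; rewrite linear0; apply/esym; apply/val_inj => /=.
    case: z => -[z zt] /= /asboolP /= /(congr1 val) /= z0.
    have : [set x | res_diff E 0 x = 0] z by [].
    rewrite res_exact0 => -[m _ mz].
    have [|u um] := @subm_lift M m.
      by apply: (torsion_inj (@res_aug_inj _ _ E)); rewrite mz; apply/asboolP.
    by rewrite -mz -um -linearZ_LR -[_ *: _]/(val (r *: u)) H linear0.
rewrite (kills_syzygy n (@res_aug_inj _ _ E) (res_exact0 E)) add0n.
split=> H.
- move=> z z0 zt; have [u uz] := subm_lift zt.
  have uP : mem_submod (kerm (torsion_diff a E n.+1)) u.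
    by apply/asboolP; apply: val_inj; rewrite /= uz.
  have {}H := H (quot_map _ (Sub u uP)); rewrite -linearZ_LR in H.
  have [v _] := proj1 (quot_map_eq0 _ _) H.
  move=> /(congr1 val) /= ve; exists (val v); first exact: submP.
  by rewrite ve uz.
- move=> h; have [z <-] := quot_map_surj h; rewrite -linearZ_LR; apply/quot_map_eq0.
  case: z => z /= zP; have /asboolP /= /(congr1 val) /= z0 := zP.
  have [e et ez] := H _ z0 (submP z); have [v ve] := subm_lift et.
  by exists v => //; apply: val_inj; rewrite /= ve.
Qed.

End Resolution.

End LocalCohomologyFunctor.

(** * Noetherian modules *)

Section SubmoduleTheory.
Variables (R : comPzRingType) (M : lmodType R).
Implicit Types N S : set M.

Lemma submodule0 N : submodule N -> N 0.
Proof. by case. Qed.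

Lemma submoduleD N x y : submodule N -> N x -> N y -> N (x + y).
Proof. by case=> _ + _; apply. Qed.

Lemma submoduleZ N r x : submodule N -> N x -> N (r *: x).
Proof. by case=> _ _; apply. Qed.

Lemma submoduleB N x y : submodule N -> N x -> N y -> N (x - y).
Proof. by move=> sN Nx Ny; rewrite -scaleN1r; apply: submoduleD => //; apply: submoduleZ. Qed.

Lemma sub_span S : S `<=` span S.
Proof. by move=> x Sx N [_]; apply. Qed.

Lemma span_sub S S' : S `<=` span S' -> span S `<=` span S'.
Proof. by move=> SS'; apply: span_min => //; exact: submodule_span. Qed.

Lemma smul_mem (I : set R) N r x : I r -> N x -> smul I N (r *: x).
Proof. by move=> Ir Nx; apply: sub_span; exists r => //; exists x. Qed.

Definition noetherian_module := forall N, submodule N -> exists s : seq M, N = span [set` s].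

Lemma submodule_chain_union (f : nat -> set M) :
  (forall n, submodule (f n)) -> (forall n, f n `<=` f n.+1) ->
  submodule (\bigcup_n f n).
Proof.
move=> fs fS; have fmono m n : (m <= n)%N -> f m `<=` f n.
  by move=> /subnK <-; elim: (n - m)%N => // k IH x /IH /fS.
split=> [|x y [m _ mx] [n _ ny]|r x [n _ nx]].
- by exists 0%N => //; exact: submodule0.
- exists (maxn m n) => //; apply: submoduleD => //.
  + exact: fmono (leq_maxl m n) _ mx.
  + exact: fmono (leq_maxr m n) _ ny.
- by exists n => //; exact: submoduleZ.
Qed.

(** Without a maximal element, choice yields a strictly ascending chain; the finitely many
    generators of its union already lie in one member. *)
Lemma noetherian_max (P : set M -> Prop) N0 :
  noetherian_module -> submodule N0 -> P N0 ->
  exists N, [/\ submodule N, P N &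
    forall N', submodule N' -> P N' -> N `<=` N' -> N' `<=` N].
Proof.
move=> noeM sN0 PN0; apply: contrapT => nomax.
pose T := {N : set M | submodule N /\ P N}.
have step (N : T) : exists N' : T, sval N `<=` sval N' /\ ~ sval N' `<=` sval N.
  apply: contrapT => no; apply: nomax; exists (sval N).
  case: N no => N [sN PN] /= no; split=> // N' sN' PN' NN'.
  apply: contrapT => NN; apply: no.
  by exists (exist _ N' (conj sN' PN')).
have [nxt nxtP] := choice step.
pose f n := sval (iter n nxt (exist _ N0 (conj sN0 PN0))).
have fs n : submodule (f n) by exact: (svalP (iter n nxt _)).1.
have fS n : f n `<=` f n.+1 by exact: (nxtP _).1.
have [s sE] := noeM _ (submodule_chain_union fs fS).
suff [n fn] : exists n, [set` s] `<=` f n.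
  have [_] := nxtP (iter n nxt (exist _ N0 (conj sN0 PN0))); apply=> x fx.
  have : (\bigcup_n f n) x by exists n.+1.
  by rewrite sE; exact: (span_min (fs n) fn).
have : [set` s] `<=` \bigcup_n f n by rewrite sE; exact: sub_span.
elim: (s) => [|x t IH] xt; first by exists 0%N.
have [y ty|n nt] := IH; first by apply: xt; rewrite /= inE ty orbT.
have [|m _ mx] := xt x; first by rewrite /= inE eqxx.
have fmono i j : (i <= j)%N -> f i `<=` f j.
  by move=> /subnK <-; elim: (j - i)%N => // k IHk y /IHk /fS.
exists (maxn m n) => y; rewrite /= inE => /orP[/eqP ->|ty].
  exact: fmono (leq_maxl m n) _ mx.
by apply: fmono (leq_maxr m n) _ (nt _ _).
Qed.

Lemma noetherian_stable (f : nat -> set M) :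
  noetherian_module -> (forall n, submodule (f n)) ->
  (forall n, f n `<=` f n.+1) -> exists n, forall m, f m `<=` f n.
Proof.
move=> noeM fs fS.
have [_ [_ [n ->] nmax]] :=
  @noetherian_max (fun N => exists n, N = f n) (f 0%N) noeM (fs 0%N) (ex_intro _ 0%N erefl).
have fmono i j : (i <= j)%N -> f i `<=` f j.
  by move=> /subnK <-; elim: (j - i)%N => // k IHk y /IHk /fS.
exists n => m x mx; apply: (nmax (f (maxn m n))) => //; first by exists (maxn m n).
- exact: fmono (leq_maxr _ _).
- exact: fmono (leq_maxl _ _) _ mx.
Qed.

End SubmoduleTheory.

Section FinitelyGenerated.
Variable R : comPzRingType.
Implicit Types M A B : lmodType R.

Lemma span_cons M (m : M) (s : seq M) x :
  span [set` m :: s] x <-> exists r y, span [set` s] y /\ x = r *: m + y.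
Proof.
split=> [|[r [y [sy ->]]]]; last first.
  have sp := submodule_span [set` m :: s].
  apply: (submoduleD sp); first apply: (submoduleZ _ sp).
    by apply: sub_span; rewrite /= inE eqxx.
  apply: span_sub sy => z sz; apply: sub_span; by rewrite /= inE sz orbT.
suff : span [set` m :: s] `<=` [set x | exists r y, span [set` s] y /\ x = r *: m + y].
  by move=> h; exact: h.
have sS := submodule_span [set` s].
apply: span_min; first split.
- by exists 0, 0; split; [exact: (submodule0 sS)|rewrite scale0r addr0].
- move=> _ _ [r [y [sy ->]]] [r' [y' [sy' ->]]]; exists (r + r'), (y + y').
  by split; [exact: (submoduleD sS)|rewrite scalerDl addrACA].
- move=> c _ [r [y [sy ->]]]; exists (c * r), (c *: y).
  by split; [exact: (submoduleZ _ sS)|rewrite scalerDr scalerA].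
- move=> y; rewrite /= inE => /orP[/eqP ->|sy].
    by exists 1, 0; split; [exact: (submodule0 sS)|rewrite scale1r addr0].
  by exists 0, y; split; [exact: sub_span|rewrite scale0r add0r].
Qed.

(** Induction on the generators, for all submodules of their span: generators of the part of [N] in
    the span of [s] are joined to lifts of generators of the ideal [I] of coefficients of [m]. *)
Lemma noetherian_finitely_generated M :
  noetherian R -> finitely_generated M -> noetherian_module M.
Proof.
move=> noeR [s sT]; suff noes N : submodule N -> N `<=` span [set` s] ->
    exists t : seq M, N = span [set` t].
  by move=> N sN; apply: noes => // x _; rewrite sT.
elim: {sT} s N => [|m s IH] N sN Ns.
  exists [::]; apply/seteqP; split=> //.
  by apply: span_min => // x; rewrite /= inE.
have spS := submodule_span [set` s].
have [] := IH (N `&` span [set` s]).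
- split=> [|x y [Nx sx] [Ny sy]|r x [Nx sx]];
    split; do ?[exact: (submodule0 sN)|exact: (submodule0 spS)].
  + exact: (submoduleD sN).
  + exact: (submoduleD spS).
  + exact: (submoduleZ _ sN).
  + exact: (submoduleZ _ spS).
- by move=> x [].
move=> t tE.
pose I := [set r | exists2 y, span [set` s] y & N (r *: m + y)].
have /noeR [g gE] : ideal I.
  split=> [|r r' [y sy Ny] [y' sy' Ny']|c r [y sy Ny]].
  - exists 0; first exact: (submodule0 spS).
    by rewrite scale0r addr0; exact: (submodule0 sN).
  - exists (y + y'); first exact: (submoduleD spS).
    by rewrite scalerDl addrACA; exact: (submoduleD sN).
  - exists (c *: y); first exact: (submoduleZ _ spS).
    by rewrite -scalerA -scalerDr; exact: (submoduleZ _ sN).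
have [u [uN uI]] : exists u : seq M, [set` u] `<=` N /\
    forall r, ideal_gen g r -> exists2 y, span [set` s] y & span [set` u] (r *: m + y).
  have : [set` g] `<=` I by rewrite gE; exact: (@sub_span R R^o).
  rewrite /ideal_gen; elim: (g) => [|c h IHh] hI.
    exists [::]; split=> [x|r]; first by rewrite /= inE.
    have z : span [set` [::] : seq R^o] `<=` [set 0].
      by apply: span_min => [|x]; [exact: submodule_zero|rewrite /= inE].
    move=> /z ->; exists 0; first exact: (submodule0 spS).
    by rewrite scale0r addr0; exact: (submodule0 (submodule_span _)).
  have [x hx|u [uN uh]] := IHh; first by apply: hI; rewrite /= inE hx orbT.
  have [|y sy Ny] := hI c; first by rewrite /= inE eqxx.
  exists (c *: m + y :: u); split=> [x|r].
    by rewrite /= inE => /orP[/eqP ->|/uN].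
  move=> /(@span_cons R^o) [d [r' [/uh [y' sy' uy'] ->]]].
  exists (d *: y + y'); first by apply: (submoduleD spS) => //; exact: (submoduleZ _ spS).
  apply/span_cons; exists d, (r' *: m + y'); split=> //.
  by rewrite scalerDr scalerDl -scalerA addrACA.
exists (u ++ t); have utS := submodule_span [set` u ++ t].
have su : span [set` u] `<=` span [set` u ++ t].
  by apply: span_sub => x ux; apply: sub_span; rewrite /= mem_cat ux.
have st : span [set` t] `<=` span [set` u ++ t].
  by apply: span_sub => x tx; apply: sub_span; rewrite /= mem_cat tx orbT.
apply/seteqP; split=> [x Nx|]; last first.
  apply: (span_min sN) => x; rewrite /= mem_cat => /orP[/uN //|tx].
  suff : span [set` t] x by rewrite -tE => -[].
  exact: sub_span.
have /span_cons [r [y [sy xE]]] := Ns _ Nx.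
have [|y' sy' uy'] := uI r; first by rewrite -gE; exists y; rewrite -?xE.
rewrite -[x](subrK (r *: m + y')) addrC; apply: (submoduleD utS); first exact: su.
apply: st; rewrite -tE; split.
  apply: (submoduleB sN) => //.
  by apply: (span_min sN uN).
by rewrite xE opprD addrACA subrr add0r; exact: (submoduleB spS).
Qed.

Lemma finitely_generated_surj A B (p : {linear A -> B}) :
  (forall b, exists a, p a = b) -> finitely_generated A -> finitely_generated B.
Proof.
move=> p_surj [s sT]; exists (map p s); apply/seteqP; split=> // b _.
have [x <-] := p_surj b; have : span [set` s] x by rewrite sT.
have sp := submodule_span [set` map p s].
suff : span [set` s] `<=` [set x | span [set` map p s] (p x)] by apply.
apply: span_min => [|y sy]; last by apply: sub_span; rewrite /= map_f.
split=> [|y z sy sz|r y sy] /=.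
- by rewrite linear0; exact: (submodule0 sp).
- by rewrite linearD; exact: (submoduleD sp).
- by rewrite linearZ_LR; exact: (submoduleZ _ sp).
Qed.

End FinitelyGenerated.

(** * Injectivity of torsion submodules *)

Section Ideals.
Variable R : comPzRingType.
Implicit Types (a b I J : set R) (r s : R).

Lemma ideal0 I : ideal I -> I 0.
Proof. by case. Qed.

Lemma idealD I r s : ideal I -> I r -> I s -> I (r + s).
Proof. exact: (@submoduleD R R^o). Qed.

Lemma idealB I r s : ideal I -> I r -> I s -> I (r - s).
Proof. exact: (@submoduleB R R^o). Qed.

Lemma idealMl I r s : ideal I -> I s -> I (r * s).
Proof. exact: (@submoduleZ R R^o). Qed.

Lemma idealMr I r s : ideal I -> I r -> I (r * s).
Proof. by rewrite mulrC; exact: idealMl. Qed.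

Lemma ideal_mul_mem a b r s : a r -> b s -> @smul R R^o a b (r * s).
Proof. exact: (@smul_mem R R^o). Qed.

Lemma ideal_annihilator (M : lmodType R) (m : M) : ideal [set r | r *: m = 0].
Proof.
split=> [|r s /= r0 s0|r s /= s0]; first by rewrite /= scale0r.
- by rewrite scalerDl r0 s0 addr0.
- by rewrite -[_ *: s]/(r * s) -scalerA s0 scaler0.
Qed.

Lemma ideal_colon I x : ideal I -> ideal [set r | I (x * r)].
Proof.
move=> iI; split=> [|r s /= r0 s0|r s /= s0]; first by rewrite /= mulr0; exact: ideal0.
- by rewrite mulrDr; exact: idealD.
- by rewrite -[_ *: s]/(r * s) mulrCA; exact: idealMl.
Qed.

Definition ideal_adjoin I x : set R := [set r | exists u c, I u /\ r = u + c * x].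

Lemma ideal_ideal_adjoin I x : ideal I -> ideal (ideal_adjoin I x).
Proof.
move=> iI; split=> [|_ _ [u [c [Iu ->]]] [v [d [Iv ->]]]|r _ [u [c [Iu ->]]]].
- by exists 0, 0; split; [exact: ideal0|rewrite mul0r addr0].
- by exists (u + v), (c + d); split; [exact: idealD|rewrite mulrDl addrACA].
- exists (r * u), (r * c); split; first exact: idealMl.
  by rewrite -[_ *: _]/(r * _) mulrDr mulrA.
Qed.

Lemma sub_ideal_adjoin I x : I `<=` ideal_adjoin I x.
Proof. by move=> u Iu; exists u, 0; rewrite mul0r addr0. Qed.

Lemma mem_ideal_adjoin I x : ideal I -> ideal_adjoin I x x.
Proof. by move=> /ideal0 I0; exists 0, 1; rewrite mul1r add0r. Qed.

Lemma ideal_powS_mem a n r s : a r -> ideal_pow a n s -> ideal_pow a n.+1 (r * s).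
Proof. exact: ideal_mul_mem. Qed.

Lemma ideal_pow_min a n I : ideal I ->
  (forall r s, a r -> ideal_pow a n s -> I (r * s)) -> ideal_pow a n.+1 `<=` I.
Proof. by move=> iI aI; apply: (@span_min R R^o) => // _ [r ar [s ns <-]]; exact: aI. Qed.

Lemma ideal_powD a n m r s :
  ideal_pow a n r -> ideal_pow a m s -> ideal_pow a (n + m) (r * s).
Proof.
move=> nr ms; elim: n r nr => [|n IH] r nr.
  by apply: idealMl => //; exact: ideal_ideal_pow.
suff : ideal_pow a n.+1 `<=` [set r | ideal_pow a (n + m).+1 (r * s)] by exact.
apply: ideal_pow_min => [|x y ax /IH ys]; last by rewrite /= -mulrA; exact: ideal_powS_mem.
have iP := ideal_ideal_pow a (n + m).+1.
split=> [|x y /= xs ys|x y /= ys]; first by rewrite /= mul0r; exact: (ideal0 iP).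
- by rewrite mulrDl; exact: (idealD iP).
- by rewrite -[_ *: y]/(x * y) -mulrA; exact: (idealMl _ iP).
Qed.

Lemma ideal_pow_exp a n r : a r -> ideal_pow a n (r ^+ n).
Proof. by move=> ar; elim: n => [//|n IH]; rewrite exprS; exact: ideal_powS_mem. Qed.

Lemma ideal_pow_le a b n : a `<=` b -> ideal_pow a n `<=` ideal_pow b n.
Proof.
move=> ab; elim: n => [//|n IH]; apply: ideal_pow_min; first exact: ideal_ideal_pow.
by move=> r s /ab br /IH bs; exact: ideal_powS_mem.
Qed.

Lemma ideal_pow1 a r : a r -> ideal_pow a 1 r.
Proof. by move=> ar; rewrite -[r]mulr1; exact: ideal_powS_mem. Qed.

Lemma ideal_pow_sub a n : ideal a -> ideal_pow a n.+1 `<=` a.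
Proof. by move=> ia; apply: ideal_pow_min => // r s ar _; exact: idealMr. Qed.

(** Of [k + n] factors, either [k] can be taken from [b] or [n] from the multiples of [x]. *)
Lemma ideal_pow_adjoin b x k n :
  ideal_pow (ideal_adjoin b x) (k + n) `<=` ideal_adjoin (ideal_pow b k) (x ^+ n).
Proof.
move E: (k + n)%N => m; elim: m k n E => [|m IH] k n E.
  by case: k n E => [|k] [|n] // _ r _; exists r, 0; rewrite mul0r addr0.
case: k E => [|k] E; first by move=> r _; exists r, 0; rewrite mul0r addr0.
case: n E => [|n] E.
  move=> r _; exists 0, r; split; last by rewrite expr0 mulr1 add0r.
  by exact: (ideal0 (ideal_ideal_pow b k.+1)).
apply: ideal_pow_min; first exact/ideal_ideal_adjoin/ideal_ideal_pow.
move=> _ y [u [c [bu ->]]] my; have iA j i := ideal_ideal_adjoin (x ^+ j) (ideal_ideal_pow b i).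
rewrite mulrDl; apply: (idealD (iA _ _)).
  have [|v [d [bv ->]]] := IH k n.+1 _ y my; first by move: E; rewrite addSn => -[].
  exists (u * v), (u * d); split; first exact: ideal_powS_mem.
  by rewrite mulrDr mulrA.
have [|v [d [bv ->]]] := IH k.+1 n _ y my; first by move: E; rewrite addnS => -[].
exists (c * x * v), (c * d); split; first by apply: (idealMl _ (ideal_ideal_pow b k.+1)).
by rewrite mulrDr exprS !mulrA (mulrAC c d).
Qed.

Section Noetherian.
Hypothesis noeR : noetherian R.

Lemma noetherian_ideal_max (P : set R -> Prop) I0 : ideal I0 -> P I0 ->
  exists I, [/\ ideal I, P I & forall J, ideal J -> P J -> I `<=` J -> J `<=` I].
Proof. exact: (@noetherian_max R R^o). Qed.

(** A maximal ideal [b] inside [a] with a power in [I] is all of [a], because by [ideal_pow_adjoin]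
    any [r] in [a] can be adjoined to it. *)
Lemma ideal_pow_sub_of_radical a I : ideal a -> ideal I ->
  (forall r, a r -> exists n, I (r ^+ n)) -> exists k, ideal_pow a k `<=` I.
Proof.
move=> ia iI rI.
have [||b [ib [ba [k bk]] bmax]] := @noetherian_ideal_max
    (fun b => b `<=` a /\ exists k, ideal_pow b k `<=` I) [set 0].
- exact: (@submodule_zero R R^o).
- split=> [_ ->|]; first exact: ideal0.
  by exists 1%N; apply: ideal_pow_min => // _ s -> _; rewrite mul0r; exact: ideal0.
exists k => x kx; apply: (bk); apply: ideal_pow_le kx => r ar.
apply: (bmax (ideal_adjoin b r)).
- exact: ideal_ideal_adjoin.
- split=> [_ [u [c [bu ->]]]|].
    by apply: idealD => //; [exact: ba|exact: idealMl].
  have [n rn] := rI _ ar; exists (k + n)%N => y /ideal_pow_adjoin [u [c [bu ->]]].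
  by apply: idealD => //; [exact: bk|exact: idealMl].
- exact: sub_ideal_adjoin.
- exact: mem_ideal_adjoin.
Qed.

(* A weak Artin-Rees lemma: take [K] maximal among the ideals containing
   [a ^ n I] that meet [I] in [a ^ n I]; every element of [a] has a power in [K]. *)
Lemma artin_rees a I n : ideal a -> ideal I -> exists m,
  forall r, ideal_pow a m r -> I r -> @smul R R^o (ideal_pow a n) I r.
Proof.
move=> ia iI; set J := @smul R R^o (ideal_pow a n) I.
have iJ : ideal J by exact: submodule_span.
have [|K [iK [JK KI] Kmax]] := @noetherian_ideal_max
    (fun K => J `<=` K /\ forall r, K r -> I r -> J r) J iJ.
  by split.
have [x ax|m am] := @ideal_pow_sub_of_radical a K ia iK; last first.
  by exists m => r /am; exact: KI.
have [||k kP] := @noetherian_stable R R^o (fun k => [set r | K (x ^+ k * r)]) noeR.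
- by move=> k; exact: (ideal_colon (x ^+ k) iK).
- by move=> k r /= Kr; rewrite exprS -mulrA; exact: idealMl.
exists k; apply: (Kmax (ideal_adjoin K (x ^+ k))).
- exact: ideal_ideal_adjoin.
- split=> [r /JK|_ [u [c [Ku ->]]] Ir]; first exact: sub_ideal_adjoin.
  (* For [u + c x ^ k] in [I], the product with [x ^ n] lies in [J], hence in [K]. So
     [x ^ (n + k) c] is in [K], and by stability so is [x ^ k c]. *)
  apply: (KI) => //; apply: idealD => //; rewrite mulrC.
  apply: (kP (n + k)%N); rewrite /= exprD -mulrA.
  have /JK : J (x ^+ n * (u + c * x ^+ k)).
    by apply: ideal_mul_mem => //; exact: ideal_pow_exp.
  rewrite mulrDr [c * _]mulrC => Kx.
  have Kxu : K (x ^+ n * u) by exact: idealMl.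
  by have := idealB iK Kx Kxu; rewrite addrAC subrr add0r.
- exact: sub_ideal_adjoin.
- exact: mem_ideal_adjoin.
Qed.

Lemma torsionP a (M : lmodType R) (m : M) : ideal a ->
  is_torsion a m <-> forall r, a r -> exists n, r ^+ n *: m = 0.
Proof.
move=> ia; split=> [[n nm] r ar|]; first by exists n; apply: nm; exact: ideal_pow_exp.
by move=> /(ideal_pow_sub_of_radical ia (ideal_annihilator m)) [k kI]; exists k.
Qed.

End Noetherian.
End Ideals.

(** Zorn's lemma for the sets whose union with [X0] satisfies [P]; the empty chain then amounts to
    [P X0]. *)
Lemma zorn_above T (P : set T -> Prop) (X0 : set T) : P X0 ->
  (forall F : set (set T), F !=set0 -> F `<=` P -> total_on F subset ->
    P (\bigcup_(X in F) X)) ->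
  exists X, [/\ X0 `<=` X, P X & forall Y, P Y -> X `<=` Y -> Y `<=` X].
Proof.
move=> PX0 Pchain.
have [F FP Ftot|X [PX Xmax]] := @Zorn_bigcup T [set X | P (X `|` X0)].
  have [->|/set0P F0] := eqVneq F set0; first by rewrite /= bigcup_set0 set0U.
  rewrite /= (_ : _ `|` _ = \bigcup_(Y in [set X `|` X0 | X in F]) Y); last first.
    apply/seteqP; split=> [x [[X FX Xx]|Xx]|x [_ [X FX <-] [Xx|Xx]]].
    - by exists (X `|` X0); [exists X|left].
    - by have [X FX] := F0; exists (X `|` X0); [exists X|right].
    - by left; exists X.
    - by right.
  apply: Pchain; first by have [X FX] := F0; exists (X `|` X0), X.
    by move=> _ [X FX <-]; exact: FP.
  move=> _ _ [X FX <-] [Y FY <-]; have [XY|YX] := Ftot _ _ FX FY.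
  - by left; exact: setSU.
  - by right; exact: setSU.
exists (X `|` X0); split=> // Y PY XY y Yy.
left; apply: contrapT => Xy; apply: (Xmax Y).
  by split; [move=> x Xx; apply: XY; left|move=> /(_ _ Yy)].
by rewrite /= (_ : Y `|` X0 = Y) //; apply/setUidPl => x Xx; apply: XY; right.
Qed.

(** * Baer's criterion and vanishing on torsion modules *)

Section Baer.
Variable R : comPzRingType.
Implicit Types A B G : lmodType R.

(* [X] is the graph of a linear map from an ideal to [G]. *)
Lemma baer G :
  (forall X : set (R^o * G), submodule X -> (forall g, X (0, g) -> g = 0) ->
    exists g0, forall r g, X (r, g) -> g = r *: g0) ->
  injective_module G.
Proof.
move=> baerG A B i f inj_i.
pose P (X : set (B * G)) := submodule X /\ forall g, X (0, g) -> g = 0.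
have [||X [fX [sX X0] Xmax]] := @zorn_above _ P (range (fun x => (i x, f x))).
- split=> [|g [x _ [ix <-]]]; last first.
    by rewrite (_ : x = 0) ?linear0 //; apply: inj_i; rewrite linear0.
  split=> [|_ _ [x _ <-] [y _ <-]|r _ [x _ <-]].
  - by exists 0; rewrite ?linear0.
  - by exists (x + y); rewrite ?linearD.
  - by exists (r *: x); rewrite ?linearZ_LR.
- move=> F [X FX] FP Ftot; split; last by move=> g [Y /FP [_ Y0] /Y0].
  split=> [|x y [Y FY Yx] [Z FZ Zy]|r x [Y FY Yx]].
  - by exists X => //; have [[]] := FP _ FX.
  - have [YZ|ZY] := Ftot _ _ FY FZ.
    + by exists Z => //; apply: (submoduleD (FP _ FZ).1) => //; exact: YZ.
    + by exists Y => //; apply: (submoduleD (FP _ FY).1) => //; exact: ZY.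
  - by exists Y => //; exact: (submoduleZ _ (FP _ FY).1).
have Xfun b g g' : X (b, g) -> X (b, g') -> g = g'.
  move=> Xg Xg'; apply/eqP; rewrite -subr_eq0; apply/eqP/X0.
  by have := submoduleB sX Xg Xg'; rewrite -[X in X -> _]/(X (b - b, g - g')) subrr.
have Xtot b : exists g, X (b, g).
  (* The maximal graph [X] defines a map on the ideal of those [r] with [r b] in its domain. The
     element [g0] representing it is a consistent value at [b], so maximality puts [(b, g0)] in
     [X]. *)
  have [||g0 g0P] := baerG [set rg | X (rg.1 *: b, rg.2)].
  - split=> [|[r g] [s h] /= Xg Xh|c [r g] /= Xg] /=.
    + by rewrite scale0r; exact: (submodule0 sX).
    + by rewrite scalerDl; exact: (submoduleD sX Xg Xh).
    + by rewrite -[_ *: r]/(c * r) -scalerA; exact: (submoduleZ c sX Xg).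
  - by move=> g /=; rewrite scale0r; exact: X0.
  pose Y := [set x : B * G | exists bg r, X bg /\ x = bg + r *: (b, g0)].
  exists g0; apply: (Xmax Y).
  - split=> [|g [[c h] [r [Xh [/eqP]]]]].
    + split=> [|_ _ [u [r [Xu ->]]] [v [s [Xv ->]]]|c _ [u [r [Xu ->]]]].
      * by exists 0, 0; split; [exact: (submodule0 sX)|rewrite scale0r addr0].
      * exists (u + v), (r + s); split; first exact: (submoduleD sX).
        by rewrite scalerDl addrACA.
      * exists (c *: u), (c * r); split; first exact: (submoduleZ _ sX).
        by rewrite scalerDr scalerA.
    + rewrite eq_sym addrC addr_eq0 => /eqP rb ->.
      have /g0P /= hE : X ((- r) *: b, h) by rewrite scaleNr rb opprK.
      by rewrite hE scaleNr addNr.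
  - by move=> x Xx; exists x, 0; rewrite scale0r addr0.
  - by exists 0, 1; split; [exact: (submodule0 sX)|rewrite scale1r add0r].
have [g gP] := choice Xtot.
have gL : linear g.
  move=> r x y; apply: (Xfun (r *: x + y)) => //.
  exact: (submoduleD sX (submoduleZ r sX (gP x)) (gP y)).
exists (linear_of gL) => x; rewrite linear_ofE; apply: (Xfun (i x)) => //.
by apply: fX; exists x.
Qed.

Variable a : set R.
Hypotheses (noeR : noetherian R) (ia : ideal a).

(** By the ascending chain condition, a map from an ideal [I] to the torsion of [E] has image killed
    by some [a ^ n]. By Artin-Rees it vanishes on the part of [I] in some [a ^ m], so it extends by
    zero to [I + a ^ m], then to [R] with values in [E]. The image of 1 is killed by [a ^ m], hence
    torsion. *)
Lemma torsion_injective (E : lmodType R) :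
  injective_module E -> injective_module (subm (torsion a E)).
Proof.
move=> injE; apply: baer => X sX X0.
have Xfun r g g' : X (r, g) -> X (r, g') -> g = g'.
  move=> Xg Xg'; apply/eqP; rewrite -subr_eq0; apply/eqP/X0.
  by have := submoduleB sX Xg Xg'; rewrite -[X in X -> _]/(X (r - r, g - g')) subrr.
pose dom n := [set r | exists2 g, X (r, g) & forall s, ideal_pow a n s -> s *: g = 0].
have [||n nP] := @noetherian_stable R R^o dom noeR.
- move=> n; split=> [|r s [g Xg g0] [h Xh h0]|c r [g Xg g0]].
  + by exists 0; [exact: (submodule0 sX)|move=> s _; rewrite scaler0].
  + exists (g + h); first exact: (submoduleD sX Xg Xh).
    by move=> t nt; rewrite scalerDr g0 // h0 // addr0.
  + exists (c *: g); first exact: (submoduleZ c sX Xg).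
    by move=> t nt; rewrite scalerA mulrC -scalerA g0 // scaler0.
- move=> n r [g Xg g0]; exists g => // s ns; apply: g0.
  exact: sub_ideal_pow ns.
have Xn r g s : X (r, g) -> ideal_pow a n s -> s *: g = 0.
  move=> Xg ns; have [k gk] := submP g.
  have [|h Xh h0] := nP k r.
    by exists g => // t kt; apply: val_inj; rewrite /= gk.
  by rewrite (Xfun _ _ _ Xg Xh) h0.
pose I := [set r | exists g, X (r, g)].
have iI : ideal I.
  split=> [|r s [g Xg] [h Xh]|c r [g Xg]].
  - by exists 0; exact: (submodule0 sX).
  - by exists (g + h); exact: (submoduleD sX Xg Xh).
  - by exists (c *: g); exact: (submoduleZ c sX Xg).
have [m mI] := artin_rees noeR n ia iI.
have Xm r g : X (r, g) -> ideal_pow a m r -> g = 0.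
  move=> Xg mr; apply: (Xfun r) => //.
  suff : @smul R R^o (ideal_pow a n) I `<=` [set r | X (r, 0)].
    by apply; apply: mI => //; exists g.
  apply: span_min => [|_ [s ns [u [h Xh] <-]]].
    split=> [|u v Xu Xv|c u Xu].
    - exact: (submodule0 sX).
    - by have := submoduleD sX Xu Xv; rewrite -[X in X -> _]/(X (u + v, 0 + 0)) addr0.
    - have := submoduleZ c sX Xu; rewrite -[X in X -> _]/(X (c *: u : R^o, c *: 0)).
      by rewrite scaler0.
  have := submoduleZ s sX Xh; rewrite -[X in X -> _]/(X (s *: u : R^o, s *: h)).
  by rewrite (Xn _ _ _ Xh).
(* The graph of the extension by zero to [I + a ^ m]. *)
pose X' := [set x : R^o * E | exists r g t, [/\ X (r, g), ideal_pow a m t & x = (r + t, val g)]].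
have sX' : submodule X'.
  have iP := ideal_ideal_pow a m.
  split=> [|_ _ [r [g [t [Xg mt ->]]]] [s [h [u [Xh mu ->]]]]|c _ [r [g [t [Xg mt ->]]]]].
  - exists 0, 0, 0; split; [exact: (submodule0 sX)|exact: (ideal0 iP)|].
    by rewrite addr0.
  - exists (r + s), (g + h), (t + u); split.
    + exact: (submoduleD sX Xg Xh).
    + exact: (idealD iP).
    + by rewrite addrACA.
  - exists (c * r), (c *: g), (c * t); split.
    + exact: (submoduleZ c sX Xg).
    + exact: (idealMl _ iP).
    + by rewrite -mulrDr.
have [|k kP] := @injective_extend R R^o E (Submod sX') injE.
  move=> e [r [g [t [Xg mt []]]]] /eqP; rewrite eq_sym addr_eq0 => /eqP rt ->.
  rewrite (Xm _ _ Xg) // rt -mulN1r; exact: (idealMl _ (ideal_ideal_pow a m)).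
have kE (r : R) : k r = r *: k (1 : R^o).
  by rewrite -linearZ_LR; congr (k _); exact: (esym (mulr1 r)).
have [|g0 g0E] := @subm_lift R a E (k (1 : R^o)).
  exists m => t mt; rewrite -kE; apply: kP; exists 0, 0, t; split=> //.
    exact: (submodule0 sX).
  by rewrite add0r.
exists g0 => r g Xg; apply: val_inj; rewrite /= -[sval g0]/(val g0) g0E -kE; apply/esym/kP.
exists r, g, 0; split=> //; last by rewrite addr0.
exact: (ideal0 (ideal_ideal_pow a m)).
Qed.

(** [M] embeds in the torsion part of [env M], an injective module all of whose quotients are
    torsion. In degree 1 the torsion functor keeps the quotient map surjective; higher degrees shift
    down. *)
Lemma lc_torsion_module n (M : lmodType R) :
  (forall x : M, is_torsion a x) -> forall h : lc a n.+1 M, h = 0.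
Proof.
elim: n M => [|n IH] M tM;
  have [j jE] := @factor_inj R M (subm (torsion a (env M))) (env M) val (env_in M) val_inj
    (fun x => subm_lift (torsion_linear (env_in M) (tM x)));
  (have inj_j : injective j by move=> x y /(congr1 val);
     rewrite !jE; exact: (se_inj (short_exact_env M)));
  have se := short_exact_quot inj_j => h;
  have injE := torsion_injective (@env_injective R M);
  have [|u <-] := satm_map_eq0 se (h := h); try exact: satm_injective.
- have [y yu] := quot_map_surj (val u).
  have [v vy] := @subm_lift R a _ y (torsion_inj val_inj (submP y)).
  have <- : torsion_map a (quot_map (imm j)) v = u by apply: val_inj; rewrite /= vy.
  exact: (connecting_fmap (T := torsion_functor a)).
- rewrite (IH _ _ u) ?linear0 // => x; have [y <-] := quot_map_surj x.
  have yt : is_torsion a y := torsion_inj val_inj (submP y).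
  exact: (torsion_linear (quot_map _) yt).
Qed.

End Baer.

(** * Weak sequences *)

Section Homothety.
Variables (R : comPzRingType) (M : lmodType R).

Lemma short_exact_subm (N : submod M) :
  short_exact (val : {linear subm N -> M}) (quot_map N).
Proof.
split=> [|m|c]; [exact: val_inj| |exact: quot_map_surj].
rewrite quot_map_eq0; split=> [Nm|[[y /asboolP Ny] /= <-] //].
by have Nm' : mem_submod N m by [apply/asboolP]; exists (Sub m Nm').
Qed.

Definition mod_mul (x : R) : lmodType R := quotm (imm (homothety M x)).
Definition mod_mul_map (x : R) : {linear M -> mod_mul x} := quot_map _.
Definition tors_quot (x : R) : lmodType R := quotm (kerm (homothety M x)).
Definition tors_quot_map (x : R) : {linear M -> tors_quot x} := quot_map _.

Lemma mod_mul_map_surj x (y : mod_mul x) : exists m, mod_mul_map x m = y.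
Proof. exact: quot_map_surj. Qed.

Lemma mod_mul_map_eq0 x m : mod_mul_map x m = 0 <-> exists m', x *: m' = m.
Proof.
rewrite quot_map_eq0; split=> [[m' _]|[m' <-]].
  by rewrite homothetyE; exists m'.
by exists m'; rewrite ?homothetyE.
Qed.

Lemma short_exact_tors x :
  short_exact (val : {linear subm (kerm (homothety M x)) -> M}) (tors_quot_map x).
Proof. exact: short_exact_subm. Qed.

(** Multiplication by [x] identifies [M / (0 :_M x)] with [x M]. *)
Lemma short_exact_mul x : exists j : {linear tors_quot x -> M},
  short_exact j (mod_mul_map x) /\ forall m, j (tors_quot_map x m) = x *: m.
Proof.
have se := short_exact_tors x.
have pE m : tors_quot_map x m = 0 <-> x *: m = 0.
  by rewrite quot_map_eq0 /= homothetyE.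
have [m /pE|j jE] := factor_surj (f := homothety M x) (se_surj se).
  by rewrite homothetyE.
have jE' m : j (tors_quot_map x m) = x *: m by rewrite jE homothetyE.
exists j; split=> //; split=> [|m|y]; last exact: mod_mul_map_surj.
  apply: linear_inj => c; have [m <-] := se_surj se c.
  by rewrite jE' => /pE.
rewrite mod_mul_map_eq0; split=> [[m' <-]|[c <-]].
  by exists (tors_quot_map x m'); rewrite jE'.
by have [m' <-] := se_surj se c; exists m'; rewrite jE'.
Qed.

End Homothety.

Section WeakSequences.
Variables (R : comPzRingType) (a : set R).
Implicit Types (M A B : lmodType R) (x : R) (s : seq R).

Lemma smul_surj A B (p : {linear A -> B}) (I : set R) y :
  (forall b, exists z, p z = b) ->
  smul I [set: B] y <-> exists2 z, smul I [set: A] z & p z = y.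
Proof.
move=> p_surj; have sA := submodule_span [set r *: m | r in I & m in [set: A]].
have sB := submodule_span [set r *: m | r in I & m in [set: B]].
split=> [|[z Iz <-]].
  suff : smul I [set: B] `<=` [set y | exists2 z, smul I [set: A] z & p z = y] by exact.
  apply: span_min => [|_ [r Ir [b _ <-]]].
    split=> [|_ _ [u Iu <-] [v Iv <-]|r _ [u Iu <-]].
    - by exists 0; [exact: (submodule0 sA)|rewrite linear0].
    - by exists (u + v); [exact: (submoduleD sA)|rewrite linearD].
    - by exists (r *: u); [exact: (submoduleZ _ sA)|rewrite linearZ_LR].
  have [z <-] := p_surj b; exists (r *: z); last exact: linearZ_LR.
  exact: smul_mem.
move: z Iz; change (smul I [set: A] `<=` [set z | smul I [set: B] (p z)]).
apply: span_min => [|_ [r Ir [z _ <-]]]; last first.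
  by rewrite /= linearZ_LR; exact: smul_mem.
split=> [|u v Iu Iv|r u Iu] /=.
- by rewrite linear0; exact: (submodule0 sB).
- by rewrite linearD; exact: (submoduleD sB).
- by rewrite linearZ_LR; exact: (submoduleZ _ sB).
Qed.

Lemma smul_gen_nil M (m : M) : smul (ideal_gen [::]) [set: M] m <-> m = 0.
Proof.
split=> [|->]; last exact: (submodule0 (submodule_span _)).
suff h : smul (ideal_gen [::]) [set: M] `<=` [set 0] by exact: h.
apply: span_min => [|_ [r r0 [m' _ <-]]]; first exact: submodule_zero.
have -> : r = 0; last by rewrite /= scale0r.
apply: (@span_min R R^o [set` [::]] [set 0]) r0; first exact: submodule_zero.
by move=> y; rewrite /= inE.
Qed.

Lemma smul_gen_cons M x s (m : M) : smul (ideal_gen (x :: s)) [set: M] m <->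
  exists m', smul (ideal_gen s) [set: M] (m - x *: m').
Proof.
have sS := submodule_span [set r *: m | r in ideal_gen s & m in [set: M]].
have sX := submodule_span [set r *: m | r in ideal_gen (x :: s) & m in [set: M]].
split=> [|[m' sm]].
  suff : smul (ideal_gen (x :: s)) [set: M] `<=`
    [set m | exists m', smul (ideal_gen s) [set: M] (m - x *: m')] by exact.
  apply: span_min => [|_ [r xr [y _ <-]]].
    split=> [|u v [u' su] [v' sv]|r u [u' su]].
    - by exists 0; rewrite scaler0 subr0; exact: (submodule0 sS).
    - exists (u' + v'); rewrite scalerDr opprD addrACA; exact: (submoduleD sS).
    - exists (r *: u'); rewrite scalerA mulrC -scalerA -scalerBr.
      exact: (submoduleZ _ sS).
  have [c [d [sd ->]]] := (@span_cons R R^o x s r).1 xr.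
  exists (c *: y); have -> : (c * x + d : R) *: y - x *: (c *: y) = d *: y.
    by rewrite scalerDl scalerA (mulrC x) addrAC subrr add0r.
  exact: smul_mem.
rewrite -[m](subrK (x *: m')); apply: (submoduleD sX); last first.
  by apply: smul_mem => //; apply: (@sub_span R R^o); rewrite /= inE eqxx.
apply: span_sub sm => _ [r sr [y _ <-]]; apply: smul_mem => //.
apply: (@span_sub R R^o) sr => z sz; apply: (@sub_span R R^o).
by rewrite /= inE sz orbT.
Qed.

Lemma smul_gen_mod_mul M x s (m : M) :
  smul (ideal_gen s) [set: mod_mul M x] (mod_mul_map M x m) <->
  smul (ideal_gen (x :: s)) [set: M] m.
Proof.
rewrite (smul_surj _ _ (@mod_mul_map_surj R M x)) smul_gen_cons.
split=> [[y sy /esym/eqP]|[m' sm']].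
  rewrite -subr_eq0 -linearB => /eqP/mod_mul_map_eq0 [m' m'E].
  by exists m'; rewrite m'E opprB addrC subrK.
exists (m - x *: m') => //; rewrite linearB.
by have -> := (mod_mul_map_eq0 x (x *: m')).2 (ex_intro _ m' erefl); rewrite subr0.
Qed.

(** Both implications between (ii) and (iii) are inductions along this recursion. *)
Lemma weak_sequence_cons M x s : weak_sequence a M (x :: s) <->
  (forall (m : M) r, x *: m = 0 -> a r -> r *: m = 0) /\
  weak_sequence a (mod_mul M x) s.
Proof.
split=> [w|[w0 w] [|i] ilt].
- split=> [m r xm ar|i ilt].
    have := w 0%N isT m; rewrite take0 /= => H.
    by apply/smul_gen_nil; apply: H => // _ ->; apply/smul_gen_nil.
  move=> /= y; have [m <-] := mod_mul_map_surj y => H r ar.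
  rewrite -linearZ_LR; apply/smul_gen_mod_mul.
  refine (w i.+1 ilt m _ r ar) => _ ->; apply/smul_gen_mod_mul.
  by rewrite linearZ_LR; exact: H.
- rewrite take0 /= => m H r ar; apply/smul_gen_nil; apply: w0 => //.
  by apply/smul_gen_nil; exact: (H x).
- move=> /= m H r ar; apply/smul_gen_mod_mul; rewrite linearZ_LR.
  refine (w i ilt _ _ r ar) => _ ->; rewrite -linearZ_LR; apply/smul_gen_mod_mul; exact: H.
Qed.

Hypotheses (noeR : noetherian R) (ia : ideal a).

(** If [a ^ (n + 2)] kills [m], then [x], being in [a ^ 2], kills [a ^ n m]. Hence so does [a], and
    the exponent drops until it is 1. *)
Lemma kills_of_annihilator M x : (forall m : M, is_torsion a m) ->
  ideal_pow a 2 x -> (forall (m : M) r, x *: m = 0 -> a r -> r *: m = 0) ->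
  forall r, a r -> kills r M.
Proof.
move=> tM x2 xM.
have down n (m : M) : (forall r, ideal_pow a n.+2 r -> r *: m = 0) ->
    forall r, ideal_pow a n.+1 r -> r *: m = 0.
  move=> m0; have := ideal_pow_min (ideal_annihilator m); apply.
  move=> r s ar ns; rewrite /= -scalerA; apply: xM => //.
  by rewrite scalerA; apply: m0; rewrite -[n.+2]/(2 + n)%N; exact: ideal_powD.
move=> r ar m; have [[|n] nm] := tM m.
  by rewrite -[m]scale1r nm // scaler0.
elim: n nm => [|n IH] nm; last by apply: IH; exact: down.
by apply: nm; exact: ideal_pow1.
Qed.

Lemma torsion_annihilator M x : (forall (m : M) r, x *: m = 0 -> a r -> r *: m = 0) ->
  forall m : subm (kerm (homothety M x)), is_torsion a m.
Proof.
move=> xM [m mP]; exists 1%N => r /(ideal_pow_sub ia) ar; apply: val_inj => /=.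
by apply: xM => //; move/asboolP: mP; rewrite /= homothetyE.
Qed.

Lemma lc_tors_quot_surj M x n (v : lc a n.+1 (tors_quot M x)) :
  (forall (m : M) r, x *: m = 0 -> a r -> r *: m = 0) ->
  exists u, fmap (lc a n.+1) (tors_quot_map M x) u = v.
Proof.
move=> xM; apply: (connecting_eq0 (se := short_exact_tors M x)).
exact: (lc_torsion_module noeR ia (n := n.+1) (torsion_annihilator xM)).
Qed.

Lemma weak_sequence_kills s : forall M, [set` s] `<=` ideal_pow a 2 ->
  weak_sequence a M s -> forall n, (n < size s)%N -> forall r, a r -> kills r (lc a n M).
Proof.
elim: s => [//|x s IH] M s2 /weak_sequence_cons [xM w] n ns.
have x2 : ideal_pow a 2 x by apply: s2; rewrite /= inE eqxx.
apply: (kills_of_annihilator (@lc_torsion R a n M) x2) => h r xh ar.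
case: n ns h xh => [|n] ns h xh.
  by apply: val_inj; apply: xM => //; have := congr1 val xh.
have [j [se jE]] := short_exact_mul M x.
(* [j] after the projection is multiplication by [x], which kills [h]. So the image of [h] comes
   from degree [n] of [M / x M], where the shorter sequence applies. *)
have jph : fmap (lc a n.+1) j (fmap (lc a n.+1) (tors_quot_map M x) h) = 0.
  rewrite -(fmap_comp (h := homothety M x)); last by move=> m; rewrite jE homothetyE.
  by rewrite (fmap_scale (r := x)) // => m; rewrite homothetyE.
have [u uE] := satm_map_eq0 se jph.
have rh0 : fmap (lc a n.+1) (tors_quot_map M x) (r *: h) = 0.
  rewrite linearZ_LR -uE -linearZ_LR (IH _ _ w) ?linear0 // => y sy.
  by apply: s2; rewrite /= inE sy orbT.
have [t <-] := fmap_exact (short_exact_tors M x) rh0.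
by rewrite (lc_torsion_module noeR ia (torsion_annihilator xM) t) linear0.
Qed.

(* Writing [x] as a sum of products [r * s] with [r] and [s] in [a], the map
   induced by [x] factors through a power of [M] in such a way that the first
   factor is zero on [lc n.+1] and the second on [lc n]. *)
Lemma mod_mul_kills M x n : ideal_pow a 2 x ->
  (forall (m : M) r, x *: m = 0 -> a r -> r *: m = 0) ->
  (forall r, a r -> kills r (lc a n M)) -> (forall r, a r -> kills r (lc a n.+1 M)) ->
  forall r, a r -> kills r (lc a n (mod_mul M x)).
Proof.
move=> x2 xM kn knS.
pose p := tors_quot_map M x; have p_surj := se_surj (short_exact_tors M x).
have p_onto v := lc_tors_quot_surj (n := n) v xM.
pose fact y := exists (P : lmodType R) (f : {linear tors_quot M x -> P})
  (g : {linear P -> M}), [/\ forall m, g (f (p m)) = y *: m,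
    forall u, fmap (lc a n.+1) f u = 0 & forall u, fmap (lc a n) g u = 0].
(* A product [r s] factors as multiplication by [s] from [M / (0 :_M x)] to [M], then by [r]. Sums
   go through the product of the middle modules. *)
have : ideal_pow a 2 `<=` fact.
  apply: ideal_pow_min => [|r s ar /(ideal_pow_sub ia) as_]; last first.
    have [m /quot_map_eq0|f fE] := factor_surj (p := p) (f := homothety M s) p_surj.
      by rewrite /= !homothetyE => xm; exact: xM.
    exists M, f, (homothety M r); split=> [m|u|u].
    - by rewrite fE !homothetyE scalerA.
    - have [w <-] := p_onto u; rewrite -(fmap_comp (h := homothety M s)) //.
      by rewrite (fmap_scale (r := s)) ?knS // => m; rewrite homothetyE.
    - by rewrite (fmap_scale (r := r)) ?kn // => m; rewrite homothetyE.
  split=> [|y y' [P [f [g [gf f0 g0]]]] [P' [f' [g' [gf' f0' g0']]]]|c y [P [f [g [gf f0 g0]]]]].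
  - exists M, \0, \0; split=> [m|u|u]; first by rewrite scale0r.
    + exact: fmap0.
    + exact: fmap0.
  - have i1L : linear (fun u => (u, 0) : P * P').
      by move=> r u v; congr pair; rewrite /= scaler0 addr0.
    have i2L : linear (fun u => (0, u) : P * P').
      by move=> r u v; congr pair; rewrite /= scaler0 addr0.
    pose i1 := linear_of i1L; pose i2 := linear_of i2L.
    exists (P * P')%type, ((i1 \o f) \+ (i2 \o f')), ((g \o fst) \+ (g' \o snd)).
    split=> [m|u|u].
    + by rewrite /= [i1 _]linear_ofE [i2 _]linear_ofE /= addr0 add0r gf gf' scalerDl.
    + rewrite (fmap_add (f := i1 \o f) (g := i2 \o f')) //.
      rewrite (fmap_comp (f := f) (g := i1)) // (fmap_comp (f := f') (g := i2)) //.
      by rewrite f0 f0' !linear0 addr0.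
    + rewrite (fmap_add (f := g \o fst) (g := g' \o snd)) //.
      rewrite (fmap_comp (f := fst) (g := g)) // (fmap_comp (f := snd) (g := g')) //.
      by rewrite g0 g0' addr0.
  - exists P, (homothety P c \o f), g; split=> [m|u|//].
      by rewrite /= homothetyE linearZ_LR gf scalerA.
    by rewrite (fmap_comp (f := f) (g := homothety P c)) // f0 linear0.
move=> /(_ _ x2) [P [f [g [gf f0 g0]]]] t ta h.
have [j [se2 jE]] := short_exact_mul M x.
(* [g \o f] is the embedding of [M / (0 :_M x)] as [x M]. So [f] is injective, and [g] induces [k]
   from its cokernel to [M / x M], giving a map of short exact sequences. *)
have inj_f : injective f.
  apply: linear_inj => y; have [m <-] := p_surj y => fm.
  by apply/quot_map_eq0; rewrite /= homothetyE -gf fm linear0.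
have se1 := short_exact_quot inj_f.
have [y /(se_ker se1) [c <-]|k kE] :=
    factor_surj (f := mod_mul_map M x \o g) (se_surj se1).
  have [m <-] := p_surj c; rewrite /= gf; apply/mod_mul_map_eq0; by exists m.
have nat_k := connecting_natural (T := lc a n) (f := idfun) (g := g) (h := k) se1 se2.
have kill_tq r : a r -> kills r (lc a n.+1 (tors_quot M x)).
  by move=> ar v; have [w <-] := p_onto v; rewrite -linearZ_LR knS // linear0.
(* As [f] is zero in degree [n.+1], [h] equals some [k h'] up to a class from [M]. *)
have [h' h'E] := satm_map_eq0 se1 (f0 (connecting (lc a n) se2 h)).
have kh' : connecting (lc a n) se2 (fmap (lc a n) k h') = connecting (lc a n) se2 h.
  rewrite -nat_k; first by rewrite h'E; apply: (fmap_id (T := lc a n.+1)).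
    by move=> c; have [m <-] := p_surj c; rewrite gf jE.
  by move=> b; rewrite kE.
have [|w wE] := connecting_eq0 (T := lc a n) (se := se2) (u := h - fmap (lc a n) k h').
  by rewrite linearB kh' subrr.
(* [t h'] comes from [P], so [k] sends it to a class that factors through [g], which is zero in
   degree [n]. *)
have [|u uE] := connecting_eq0 (T := lc a n) (se := se1) (u := t *: h').
  by rewrite linearZ_LR h'E kill_tq.
have -> : h = fmap (lc a n) (mod_mul_map M x) w + fmap (lc a n) k h' by rewrite wE subrK.
rewrite scalerDr -!linearZ_LR kn // linear0 add0r /= -uE.
rewrite -(fmap_comp (h := mod_mul_map M x \o g)) //.
by rewrite (fmap_comp (f := g) (g := mod_mul_map M x)) // g0 linear0.
Qed.

End WeakSequences.

(** * Associated primes and regular elements *)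

Section AssociatedPrimes.
Variable R : comPzRingType.
Implicit Types (I J P : set R) (M : lmodType R).

Definition prime_ideal P := [/\ ideal P, ~ P 1 & forall r s, P (r * s) -> P r \/ P s].

Lemma ideal_colon_submodule M (N : set M) m : submodule N -> ideal [set r | N (r *: m)].
Proof.
move=> sN; split=> [|r s /= Nr Ns|r s /= Ns].
- by rewrite /= scale0r; exact: (submodule0 sN).
- by rewrite scalerDl; exact: (submoduleD sN).
- by rewrite -[_ *: s]/(r * s) -scalerA; exact: (submoduleZ _ sN).
Qed.

Hypothesis noeR : noetherian R.

(** A maximal one among the proper annihilators, modulo [N], of multiples of [m] is prime. *)
Lemma associated_prime M (N : set M) m : submodule N -> ~ N m ->
  exists c, prime_ideal [set r | N (r *: (c *: m))].
Proof.
move=> sN Nm; pose col c := [set r | N (r *: (c *: m))].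
have iC c : ideal (col c) by exact: ideal_colon_submodule.
have [|_ [_ [c Nc ->] cmax]] := @noetherian_ideal_max R noeR
    (fun I => exists2 c, ~ N (c *: m) & I = col c) (col 1) (iC 1).
  by exists 1 => //; rewrite scale1r.
exists c; split=> [|/=|r s /= Nrs]; [exact: iC|by rewrite scale1r|].
have [Ns|Ns] := pselect (N (s *: (c *: m))); first by right.
left; apply: (cmax (col (s * c))) => //; first by exists (s * c); rewrite // -scalerA.
  move=> t /= Nt; rewrite /col /= (_ : t *: _ = s *: (t *: (c *: m))).
    exact: (submoduleZ _ sN).
  by rewrite !scalerA -!mulrA mulrCA.
by rewrite /col /= scalerA mulrA -scalerA.
Qed.

(** Take [N] maximal with finitely many such primes. Adjoining [x] with prime annihilator modulo [N]
    adds at most that prime: an element [u] of [N + R x] with prime annihilator either has a nonzero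
    multiple in [N], with the same annihilator, or has the annihilator of [x] modulo [N]. *)
Lemma finite_associated_primes M : noetherian_module M ->
  exists ps : seq (set R), forall m : M,
    prime_ideal [set r | r *: m = 0] -> [set r | r *: m = 0] \in ps.
Proof.
move=> noeM; pose ann (m : M) := [set r | r *: m = 0].
pose finite_on (N : set M) := exists ps : seq (set R),
  forall m, N m -> prime_ideal (ann m) -> ann m \in ps.
have [|N [sN [ps psP] Nmax]] := noetherian_max (P := finite_on) noeM (@submodule_zero R M).
  by exists [::] => _ -> [_ P1 _]; case: P1; rewrite /ann /= scaler0.
exists ps => m; apply: (psP); apply: contrapT => Nm.
have [c [iP P1 Pmul]] := associated_prime sN Nm.
pose x := c *: m; pose N' := [set u | exists v d, N v /\ u = v + d *: x].
have N'x : N' x by exists 0, 1; rewrite scale1r add0r; split=> //; exact: (submodule0 sN).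
have NN' : N `<=` N' by move=> v Nv; exists v, 0; rewrite scale0r addr0.
apply: P1; rewrite /= scale1r; apply: (Nmax N') => //.
  split=> [|_ _ [u [d [Nu ->]]] [v [e [Nv ->]]]|r _ [u [d [Nu ->]]]].
  - exact: NN' (submodule0 sN).
  - by exists (u + v), (d + e); rewrite scalerDl addrACA; split=> //; exact: (submoduleD sN).
  - by exists (r *: u), (r * d); rewrite scalerDr scalerA; split=> //; exact: (submoduleZ _ sN).
exists ([set r | N (r *: x)] :: ps) => _ [v [d [Nv ->]]] [iA A1 Amul].
set u := v + d *: x in iA A1 Amul *; rewrite inE.
have [[s [su0 Nsu]]|noN] := pselect (exists s, s *: u <> 0 /\ N (s *: u)).
  have annE : ann (s *: u) = ann u.
    apply/seteqP; split=> [t|t] /=; rewrite /ann /= scalerA.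
      by move=> /Amul [].
    by move=> tu; rewrite mulrC -scalerA tu scaler0.
  by rewrite -annE psP ?orbT // annE.
have u0 : u <> 0 by move=> u0; apply: A1; rewrite /ann /= u0 scaler0.
apply/orP; left; apply/eqP/seteqP; rewrite /ann; split=> r /= ru.
  have : N ((r * d) *: x).
    rewrite -scalerA -[r *: (d *: x)](addKr (r *: v)) -scalerDr ru addr0 -scalerN.
    by apply: (submoduleZ _ sN); rewrite -scaleN1r; exact: (submoduleZ _ sN).
  case/Pmul => // Nd; case: noN; exists 1; rewrite scale1r; split=> //.
  exact: (submoduleD sN).
apply: contrapT => ru0; apply: noN; exists r; split=> //.
rewrite scalerDr; apply: (submoduleD sN); first exact: (submoduleZ _ sN).
by rewrite scalerA mulrC -scalerA; exact: (submoduleZ _ sN).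
Qed.

Lemma coset_prime_avoidance J x (ps : seq (set R)) : ideal J ->
  (forall P, P \in ps -> prime_ideal P) ->
  (forall P, P \in ps -> J `<=` P -> ~ P x) ->
  exists2 z, J z & forall P, P \in ps -> ~ P (x + z).
Proof.
move=> iJ; move E: (size ps) => n; elim: n ps E => [|n IH] [|P qs] //= E.
  by move=> _ _; exists 0 => //; exact: ideal0.
case: E => qsn prime_ps notJ.
have sub_qs Q : Q \in qs -> Q \in P :: qs by rewrite inE orbC => ->.
have mem_P : P \in P :: qs by rewrite inE eqxx.
have [|Q Qq|z Jz zqs] := IH qs qsn; first by move=> Q /sub_qs; exact: prime_ps.
  by apply: notJ; exact: sub_qs.
have [Pz|Pz] := pselect (P (x + z)); last first.
  by exists z => // Q; rewrite inE => /orP[/eqP ->|/zqs].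
have [iP P1 Pmul] := prime_ps _ mem_P.
(* If [Q] lies in [P], avoiding [P] avoids [Q], and the list without [Q] is shorter. *)
have [[Q Qq QP]|noQ] := pselect (exists2 Q, Q \in qs & Q `<=` P).
  have sub_rem S : S \in P :: rem Q qs -> S \in P :: qs.
    by rewrite !inE => /orP[->//|/mem_rem ->]; rewrite orbT.
  have [||S /sub_rem|w Jw wP] := IH (P :: rem Q qs).
  - by rewrite /= size_rem // prednK //; case: (qs) Qq.
  - by move=> S /sub_rem; exact: prime_ps.
  - exact: notJ.
  exists w => // S; rewrite inE => /orP[/eqP ->|Sqs].
    by apply: wP; rewrite inE eqxx.
  have [->|SQ] := eqVneq S Q; first by move=> /QP; apply: wP; rewrite inE eqxx.
  move: Sqs; rewrite (perm_mem (perm_to_rem Qq)) inE (negbTE SQ) => /= Sr.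
  by apply: wP; rewrite inE Sr orbT.
have [w0 Jw0 Pw0] : exists2 w, J w & ~ P w.
  apply: contrapT => no; have JP : J `<=` P.
    by move=> w Jw; apply: contrapT => Pw; apply: no; exists w.
  apply: (notJ _ mem_P JP); rewrite -[x](addrK z); apply: idealB => //; exact: JP.
(* Otherwise a product of elements outside [P], one from [J] and one from each other prime, corrects
   [z] at [P] without disturbing the rest. *)
have [w [Jw Pw wq]] : exists w, [/\ J w, ~ P w & forall Q, Q \in qs -> Q w].
  have : forall Q, Q \in qs -> prime_ideal Q by move=> Q /sub_qs; exact: prime_ps.
  have : forall Q, Q \in qs -> ~ Q `<=` P by move=> Q Qq QP; apply: noQ; exists Q.
  elim: (qs) => [|Q ts IHq] notP pr; first by exists w0.
  have [S Sts|S Sts|w [Jw Pw wq]] := IHq.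
  - by apply: notP; rewrite inE Sts orbT.
  - by apply: pr; rewrite inE Sts orbT.
  have [v Qv Pv] : exists2 v, Q v & ~ P v.
    apply: contrapT => no; apply: (notP Q); first by rewrite inE eqxx.
    by move=> v Qv; apply: contrapT => Pv; apply: no; exists v.
  exists (v * w); split=> [||S]; [exact: idealMl|by move=> /Pmul []|].
  have [iQ _ _] := pr Q (mem_head _ _).
  rewrite inE => /orP[/eqP ->|Sts]; first exact: idealMr.
  have [|iS _ _] := pr S; first by rewrite inE Sts orbT.
  by apply: idealMl => //; exact: wq.
exists (z + w) => [|Q]; first exact: idealD.
rewrite inE addrA => /orP[/eqP ->|Qq] Qxzw.
  by apply: Pw; rewrite -[w](addKr (x + z)) addrC; exact: idealB.
have [iQ _ _] := prime_ps _ (sub_qs _ Qq).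
by apply: (zqs Q Qq); rewrite -[x + z](addrK w); apply: idealB => //; exact: wq.
Qed.

(** An associated prime containing [J] and [x] would annihilate a nonzero element killed by both, so
    the coset of [x] avoids all associated primes. *)
Lemma regular_element M J x : noetherian_module M -> ideal J ->
  (forall m : M, x *: m = 0 -> (forall r, J r -> r *: m = 0) -> m = 0) ->
  exists2 z, J z & forall m : M, (x + z) *: m = 0 -> m = 0.
Proof.
move=> noeM iJ xJ; have [ps psP] := finite_associated_primes noeM.
pose assoc P := prime_ideal P /\ exists m : M, P = [set r | r *: m = 0].
(* The list may contain other sets; the filter keeps the associated primes. *)
have [P|P|z Jz zP] := @coset_prime_avoidance J x [seq P <- ps | `[< assoc P >]] iJ.
- by rewrite mem_filter => /andP[/asboolP []].
- rewrite mem_filter => /andP[/asboolP [[iP P1 _] [m PE]] _] JP Px.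
  apply: P1; rewrite PE /= scale1r; move: JP Px; rewrite PE => JP Px.
  exact: xJ.
exists z => // m xzm; apply: contrapT => m0.
have [c cprime] := associated_prime (@submodule_zero R M) m0.
apply: (zP [set r | r *: (c *: m) = 0]); last first.
  by rewrite /= scalerA mulrC -scalerA xzm scaler0.
rewrite mem_filter; apply/andP; split; last exact: psP.
by apply/asboolP; split=> //; exists (c *: m).
Qed.

Lemma jacobson_unit y : jacobson_radical R y -> exists u, u * (1 - y) = 1.
Proof.
move=> Jy; apply: contrapT => nou; pose I := [set c * (1 - y) | c in setT].
have iI : ideal I.
  split=> [|_ _ [c _ <-] [d _ <-]|r _ [c _ <-]].
  - by exists 0 => //; rewrite mul0r.
  - by exists (c + d) => //; rewrite mulrDl.
  - by exists (r * c) => //; rewrite -[_ *: _]/(r * _) mulrA.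
have [|Q [iQ [IQ Q1] Qmax]] := @noetherian_ideal_max R noeR
    (fun Q => I `<=` Q /\ ~ Q 1) I iI.
  by split=> // -[u _ u1]; apply: nou; exists u.
have Qy : Q y.
  apply: Jy; split=> // [QT|I' iI' QI']; first by apply: Q1; rewrite QT.
  have [I'1|I'1] := pselect (I' 1).
    by right; apply/seteqP; split=> // r _; rewrite -[r]mulr1; exact: idealMl.
  left; apply/seteqP; split=> //; apply: Qmax => //; split=> // r /IQ.
  exact: QI'.
apply: Q1; rewrite -[1](subrK y); apply: idealD => //; apply: IQ.
by exists 1; rewrite ?mul1r.
Qed.

(** A Nakayama argument by the ascending chain condition: if [x] in [N] generates a maximal cyclic
    submodule and [x = y x'], then [x' = r x = r y x'], where [1 - r y] is a unit. *)
Lemma jacobson_divisible M (N : set M) y : noetherian_module M ->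
  jacobson_radical R y -> (forall m, N m -> exists2 m', N m' & m = y *: m') ->
  forall m, N m -> m = 0.
Proof.
move=> noeM Jy Ndiv m Nm; apply: contrapT => m0.
pose cyc (x : M) := [set r *: x | r in [set: R]].
have sC x : submodule (cyc x).
  split=> [|_ _ [r _ <-] [s _ <-]|c _ [r _ <-]].
  - by exists 0 => //; rewrite scale0r.
  - by exists (r + s) => //; rewrite scalerDl.
  - by exists (c * r) => //; rewrite scalerA.
have [|_ [_ [x [Nx x0 ->]] xmax]] := noetherian_max (N0 := cyc m)
    (P := fun C => exists x, [/\ N x, x <> 0 & C = cyc x]) noeM (sC m).
  by exists m.
have [x' Nx' xE] := Ndiv _ Nx.
have x'0 : x' <> 0 by move=> x'0; apply: x0; rewrite xE x'0 scaler0.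
have [|||r _ rx] := xmax (cyc x') (sC x') _ _ x'; first by exists x'.
- by move=> _ [r _ <-]; exists (r * y) => //; rewrite xE scalerA.
- by exists 1; rewrite ?scale1r.
have [|u uE] := @jacobson_unit (r * y); first by move=> Q [iQ ? ?]; apply: idealMl => //; exact: Jy.
apply: x'0; rewrite -[x']scale1r -uE -scalerA scalerBl scale1r -scalerA -xE rx.
by rewrite subrr scaler0.
Qed.

End AssociatedPrimes.

(** * Filter-regular elements *)

Section FilterRegular.
Variables (R : comPzRingType) (a : set R).
Hypotheses (noeR : noetherian R) (ia : ideal a).
Implicit Types (M : lmodType R) (s : seq R).

Lemma ideal_ideal_gen s : ideal (ideal_gen s).
Proof. exact: submodule_span. Qed.

Lemma mem_ideal_gen s r : r \in s -> ideal_gen s r.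
Proof. exact: (@sub_span R R^o [set` s]). Qed.

Lemma ideal_gen_min s (I : set R) : ideal I -> [set` s] `<=` I -> ideal_gen s `<=` I.
Proof. exact: (@span_min R R^o). Qed.

Lemma ideal_gen_cons x s r :
  ideal_gen (x :: s) r <-> exists c y, ideal_gen s y /\ r = c * x + y.
Proof. exact: (@span_cons R R^o). Qed.

Lemma radical_modP M s r : radical_mod (annihilator M) (ideal_gen s) r <->
  exists n y, ideal_gen s y /\ forall m : M, r ^+ n *: m = y *: m.
Proof.
split=> [[n [y sy ry]]|[n [y [sy ry]]]]; exists n, y => //.
  split=> // m; apply/eqP; rewrite -subr_eq0 -scalerBl; apply/eqP; exact: ry.
by move=> m; rewrite scalerBl ry subrr.
Qed.

Lemma radical_mod_surj M M' (p : {linear M -> M'}) s :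
  (forall y, exists x, p x = y) ->
  radical_mod (annihilator M) (ideal_gen s) `<=` radical_mod (annihilator M') (ideal_gen s).
Proof.
move=> p_surj r /radical_modP [n [y [sy ry]]]; apply/radical_modP.
by exists n, y; split=> // m'; have [m <-] := p_surj m'; rewrite -!linearZ_LR ry.
Qed.

Lemma radical_mod_mul M x s : radical_mod (annihilator M) (ideal_gen (x :: s)) `<=`
  radical_mod (annihilator (mod_mul M x)) (ideal_gen s).
Proof.
move=> r /radical_modP [n [_ [/ideal_gen_cons [c [y [sy ->]]] ry]]].
apply/radical_modP; exists n, y; split=> // m'.
have [m <-] := mod_mul_map_surj m'; rewrite -!linearZ_LR ry; apply/eqP.
rewrite -subr_eq0 -linearB scalerDl addrK mulrC -scalerA; apply/eqP.
by apply/mod_mul_map_eq0; exists (c *: m).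
Qed.

Lemma torsion_of_gen M s (m : M) :
  a `<=` radical_mod (annihilator M) (ideal_gen s) ->
  (forall r, r \in s -> r *: m = 0) -> is_torsion a m.
Proof.
move=> as_ sm; apply/(torsionP noeR m ia) => r /as_ /radical_modP [n [y [sy ry]]].
exists n; rewrite ry; apply: (ideal_gen_min (ideal_annihilator m)) sy => t; exact: sm.
Qed.

(** Weaker than being killed by [a], but inherited by [M / y M] for any regular [y], with exponents
    adding up. *)
Definition bounded_lc n M := forall r, a r -> exists k, kills (r ^+ k) (lc a n M).

Lemma torsion_quot_torsion M (m : M) :
  is_torsion a (quot_map (torsion a M) m) -> is_torsion a m.
Proof.
move=> /(torsionP noeR _ ia) tm; apply/(torsionP noeR m ia) => r ar.
have [n] := tm r ar; rewrite -linearZ_LR => /quot_map_eq0 /=.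
case/(torsionP noeR _ ia)/(_ r ar) => k rk; exists (k + n)%N.
by rewrite exprD -scalerA.
Qed.

Lemma bounded_lc_quot_torsion n M :
  bounded_lc n M -> bounded_lc n (quotm (torsion a M)).
Proof.
case: n => [|n] bM r ar.
  exists 0%N => h; apply: val_inj; rewrite expr0 scale1r /=.
  have [y yh] := quot_map_surj (val h).
  rewrite -[sval h]/(val h) -yh; apply/quot_map_eq0 => /=.
  by apply: torsion_quot_torsion; rewrite yh; exact: submP.
have [k rk] := bM r ar; exists k => v.
have se := short_exact_subm (torsion a M).
have [|u <-] := connecting_eq0 (se := se) (u := v).
  apply: (lc_torsion_module noeR ia (n := n.+1)) => x.
  exact: (torsion_inj val_inj (submP x)).
by rewrite -linearZ_LR rk linear0.
Qed.

Lemma homothety_inj M y : (forall m : M, y *: m = 0 -> m = 0) ->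
  injective (homothety M y).
Proof. by move=> yM; apply: linear_inj => m; rewrite homothetyE; exact: yM. Qed.

Lemma bounded_lc_mod_mul n M y : (forall m : M, y *: m = 0 -> m = 0) ->
  bounded_lc n M -> bounded_lc n.+1 M -> bounded_lc n (mod_mul M y).
Proof.
move=> /homothety_inj/short_exact_quot se bn bS r ar.
have [k rk] := bn r ar; have [l rl] := bS r ar; exists (k + l)%N => h.
have [|v vE] := connecting_eq0 (T := lc a n) (se := se) (u := r ^+ l *: h).
  by rewrite linearZ_LR rl.
by rewrite exprD -scalerA -vE -linearZ_LR rk linear0.
Qed.

Lemma expr_regular M y n : (forall m : M, y *: m = 0 -> m = 0) ->
  forall m : M, y ^+ n *: m = 0 -> m = 0.
Proof.
move=> yM; elim: n => [|n IH] m; first by rewrite expr0 scale1r.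
by rewrite exprS -scalerA => /yM /IH.
Qed.

(* As [y] is regular and [Gamma M = 0], the connecting map embeds
   [Gamma (M / y ^+ t M)] in [lc 1 M], so one power of [y] kills these modules
   for all [t]. *)
Lemma uniform_torsion_bound M y : a y -> (forall m : M, y *: m = 0 -> m = 0) ->
  (forall m : M, is_torsion a m -> m = 0) -> bounded_lc 1 M ->
  exists l, forall t (m : M), is_torsion a (mod_mul_map M (y ^+ t) m) ->
    exists m', y ^+ l *: m = y ^+ t *: m'.
Proof.
move=> ay yM tM b1; have [l yl] := b1 y ay; exists l => t m tm.
have se := short_exact_quot (homothety_inj (expr_regular (n := t) yM)).
have [u um] := subm_lift tm.
have [|v vE] := connecting_eq0 (T := lc a 0) (se := se) (u := y ^+ l *: u).
  by rewrite linearZ_LR yl.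
have v0 : v = 0 by apply: val_inj; apply: tM; exact: submP.
have : mod_mul_map M (y ^+ t) (y ^+ l *: m) = 0.
  by rewrite linearZ_LR -um -[_ *: _]/(val (y ^+ l *: u)) -vE v0 linear0.
by case/mod_mul_map_eq0 => m' m'E; exists m'.
Qed.

Hypothesis aJ : a `<=` jacobson_radical R.

Lemma filter_regular s : forall x M, finitely_generated M -> [set` x :: s] `<=` a ->
  a `<=` radical_mod (annihilator M) (ideal_gen (x :: s)) ->
  (forall n, (n <= size s)%N -> bounded_lc n M) ->
  forall m : M, x *: m = 0 -> is_torsion a m.
Proof.
elim: s => [|x2 s IH] x M fgM sa arad bM m xm.
  by apply: (torsion_of_gen arad) => r; rewrite inE => /eqP ->.
(* Dividing by the torsion submodule keeps the hypotheses and turns the claim into regularity of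
   [x]. *)
suff free M' : (forall m : M', is_torsion a m -> m = 0) -> finitely_generated M' ->
    a `<=` radical_mod (annihilator M') (ideal_gen [:: x, x2 & s]) ->
    (forall n, (n <= (size s).+1)%N -> bounded_lc n M') ->
    forall m : M', x *: m = 0 -> m = 0.
  pose q := quot_map (torsion a M); have q_surj := @quot_map_surj R M (torsion a M).
  suff qm0 : q m = 0.
    by apply: torsion_quot_torsion; rewrite -/q qm0; exists 0%N => r _; rewrite scaler0.
  apply: free.
  - move=> v; have [w <-] := q_surj v => /torsion_quot_torsion wt; exact/quot_map_eq0.
  - exact: finitely_generated_surj q_surj fgM.
  - by move=> r /arad; exact: (radical_mod_surj (p := q)).
  - by move=> n /bM; exact: bounded_lc_quot_torsion.
  - by rewrite -linearZ_LR xm linear0.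
move: M' {M fgM arad bM m xm} => M tM fgM arad bM m xm.
have noeM := noetherian_finitely_generated noeR fgM.
(* Whatever [x2] and the other terms kill is torsion, hence zero, so some [y] in the coset of [x2]
   is regular. *)
have [|z Jz yreg] := regular_element noeR (x := x2) noeM (ideal_ideal_gen (x :: s)).
  move=> v x2v Jv; apply: tM; apply: (torsion_of_gen arad) => r.
  rewrite !inE => /orP[/eqP ->|/orP[/eqP -> //|rs]].
    by apply: Jv; apply: mem_ideal_gen; rewrite inE eqxx.
  by apply: Jv; apply: mem_ideal_gen; rewrite inE rs orbT.
set y := x2 + z in yreg.
have ay : a y.
  apply: (idealD ia); first by apply: sa; rewrite /= !inE eqxx orbT.
  apply: (ideal_gen_min ia) Jz => r /=; rewrite inE => /orP[/eqP ->|rs].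
    by apply: sa; rewrite /= inE eqxx.
  by apply: sa; rewrite /= !inE rs !orbT.
have genE : ideal_gen [:: x, x2 & s] `<=` ideal_gen [:: y, x & s].
  apply: (ideal_gen_min (ideal_ideal_gen _)) => r /=; rewrite !inE.
  move=> /orP[/eqP ->|/orP[/eqP ->|rs]].
  - by apply: mem_ideal_gen; rewrite !inE eqxx orbT.
  - apply/ideal_gen_cons; exists 1, (- z); split; last by rewrite mul1r /y addrK.
    by rewrite -mulN1r; exact: (idealMl _ (ideal_ideal_gen _)).
  - by apply: mem_ideal_gen; rewrite !inE rs !orbT.
have ytors (v : M) : x *: v = 0 -> is_torsion a (mod_mul_map M y v).
  move=> xv; apply: (IH x).
  - exact: finitely_generated_surj (@mod_mul_map_surj R M y) fgM.
  - by move=> r /=; rewrite inE => rxs; apply: sa; rewrite /= !inE orbCA rxs orbT.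
  - move=> r /arad [n [w /genE gw rw]]; apply: radical_mod_mul.
    by exists n, w.
  - move=> n ns; apply: (bounded_lc_mod_mul yreg); apply: bM => //.
    exact: leqW.
  - by rewrite -linearZ_LR xv linear0.
(* Up to powers of [r], division by [y] can be iterated: the quotient is again killed by [x] because
   [y] is regular. *)
have ydiv (v : M) t r : a r -> x *: v = 0 ->
    exists n w, x *: w = 0 /\ r ^+ n *: v = y ^+ t *: w.
  move=> ar; elim: t v => [|t IHt] v xv.
    by exists 0%N, v; rewrite !expr0.
  have [n [w [xw vw]]] := IHt v xv.
  have /(torsionP noeR _ ia)/(_ r ar) [k] := ytors _ xw.
  rewrite -linearZ_LR => /mod_mul_map_eq0 [w' w'E].
  exists (k + n)%N, w'; split.
    apply: yreg; rewrite scalerA mulrC -scalerA w'E scalerA mulrC -scalerA xw.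
    by rewrite scaler0.
  rewrite exprD -scalerA vw scalerA mulrC -scalerA -w'E scalerA.
  by rewrite exprSr.
have [|l lP] := uniform_torsion_bound ay yreg tM; first exact: bM.
apply: (jacobson_divisible noeR (N := [set v | x *: v = 0]) noeM (aJ ay)) xm.
(* With exponent [l.+1], cancelling [y ^+ l] leaves [v = y w]. *)
move=> v /= xv; have [|w wE] := lP l.+1 v.
  apply/(torsionP noeR _ ia) => r ar; have [n [w [xw vw]]] := ydiv v l.+1 r ar xv.
  by exists n; rewrite -linearZ_LR vw; apply/mod_mul_map_eq0; exists w.
have vE : v = y *: w.
  apply/eqP; rewrite -subr_eq0; apply/eqP/(expr_regular (n := l) yreg).
  by rewrite scalerBr wE scalerA exprSr subrr.
exists w => //; apply: yreg.
by rewrite scalerA mulrC -scalerA -vE.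
Qed.

Lemma kills_weak_sequence s : forall M, finitely_generated M ->
  [set` s] `<=` ideal_pow a 2 -> a `<=` radical_mod (annihilator M) (ideal_gen s) ->
  (forall n, (n < size s)%N -> forall r, a r -> kills r (lc a n M)) ->
  weak_sequence a M s.
Proof.
elim: s => [|x s IH] M fgM s2 arad kM; first by [].
have xM (m : M) r : x *: m = 0 -> a r -> r *: m = 0.
  (* Being killed by [a] is a bound with exponent 1, so [m] is torsion and thus a class in degree 0,
     which [a] kills. *)
  move=> xm ar; have [|u uE] := @subm_lift R a M m.
    apply: (filter_regular (s := s) (x := x)) xm => //.
      by move=> t /s2 /ideal_pow_sub; exact.
    by move=> n ns t at_; exists 1%N; rewrite expr1; exact: kM.
  by have /(congr1 val) := kM 0%N isT r ar u; rewrite /= -uE.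
apply/weak_sequence_cons; split=> //; apply: IH.
- exact: finitely_generated_surj (@mod_mul_map_surj R M x) fgM.
- by move=> t ts; apply: s2; rewrite /= inE [t \in s]ts orbT.
- by move=> r /arad; exact: radical_mod_mul.
- move=> n ns; apply: (mod_mul_kills noeR ia) => //.
  + by apply: s2; rewrite /= inE eqxx.
  + by apply: kM; exact: ltnW.
  + exact: kM.
Qed.

End FilterRegular.

(** * Relative systems of parameters *)

Section ParameterSystems.
Variables (R : comPzRingType) (a : set R) (M : lmodType R).
Hypotheses (noeR : noetherian R) (ia : ideal a).
Implicit Types (s t : seq R) (I : set R).

Lemma ideal_pow_gen_sub s I : ideal I -> (forall x, x \in s -> exists n, I (x ^+ n)) ->
  exists k, ideal_pow (ideal_gen s) k `<=` I.
Proof.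
move=> iI; elim: s => [|x s IH] sI.
  exists 1%N; apply: ideal_pow_min => // r y r0 _.
  suff -> : r = 0 by rewrite mul0r; exact: ideal0.
  by apply: (ideal_gen_min (I := [set 0])) r0; first exact: (@submodule_zero R R^o).
have [y ys|k sk] := IH; first by apply: sI; rewrite inE ys orbT.
have [|n xn] := sI x; first by rewrite inE eqxx.
exists (k + n)%N => r xr.
have [|u [c [ku ->]]] := @ideal_pow_adjoin R (ideal_gen s) x k n r.
  apply: ideal_pow_le xr => t /ideal_gen_cons [c [y [sy ->]]].
  by exists y, c; rewrite addrC.
by apply: idealD => //; [exact: sk|exact: idealMl].
Qed.


Lemma annihilator0 : annihilator M 0.
Proof. by move=> m; rewrite scale0r. Qed.

Lemma radical_mod_trans s t :
  (forall x, x \in s -> radical_mod (annihilator M) (ideal_gen t) x) ->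
  radical_mod (annihilator M) (ideal_gen s) `<=` radical_mod (annihilator M) (ideal_gen t).
Proof.
move=> st r /radical_modP [n [w [sw rw]]].
(* [I] is the sum of [ideal_gen t] and the annihilator of [M]; a power of [ideal_gen s] lies in
   it. *)
pose I := [set u | exists y, ideal_gen t y /\ forall m : M, u *: m = y *: m].
have iT := ideal_ideal_gen t.
have iI : ideal I.
  split=> [|u v [y [ty uy]] [z [tz vz]]|c u [y [ty uy]]].
  - by exists 0; split=> //; exact: (ideal0 iT).
  - by exists (y + z); split=> [|m]; [exact: (idealD iT)|rewrite !scalerDl uy vz].
  - exists (c * y); split=> [|m]; first exact: (idealMl _ iT).
    by rewrite -[c *: u]/(c * u) -!scalerA uy.
have [x /st /radical_modP [k [y [ty xy]]]|k kI] := ideal_pow_gen_sub (s := s) iI.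
  by exists k, y.
have [y [ty wy]] := kI _ (ideal_pow_exp k sw).
apply/radical_modP; exists (n * k)%N, y; split=> // m.
rewrite -wy exprM; elim: (k) => // l IHl.
by rewrite !exprS -!scalerA -IHl rw.
Qed.

Lemma infimum_nat (S : set nat) : S !=set0 ->
  exists2 n, S n & infimum +oo%E [set (k%:Z)%:E | k in S] = (n%:Z)%:E.
Proof.
case=> n0 Sn0; have ex : exists n, `[< S n >] by exists n0; apply/asboolP.
have [n /asboolP Sn nmin] := ex_minnP ex; exists n => //.
have nE : infimums [set (k%:Z)%:E | k in S] (n%:Z)%:E.
  split=> [_ [k /asboolP Sk <-]|x]; first by rewrite lee_fin lez_nat nmin.
  by apply; exists n.
rewrite /infimum; case: eqVneq => [E|_].
  have : [set (k%:Z)%:E | k in S] (n%:Z)%:E by exists n.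
  by rewrite E.
case: xgetP => [x -> xinf|/(_ (n%:Z)%:E)//].
exact: (is_subset1_infimums xinf nE).
Qed.

(** Generators of [a] make the set behind [ara] nonempty, so the infimum is attained. The resulting
    terms need not lie in [a]. *)
Lemma cd_ara_generators : cd a M = ara a M ->
  exists s, ((size s)%:Z)%:E = cd a M /\ same_radical a M (ideal_gen s).
Proof.
move=> ->; rewrite /ara; have [s0 s0E] := noeR ia.
have [|n [s <- srad] ->] := @infimum_nat
  [set n | exists2 s : seq R, size s = n & same_radical a M (ideal_gen s)].
  by exists (size s0), s0 => //; rewrite -s0E.
by exists s.
Qed.

(** Some power of each term [x] acts on [M] as an element [y] of [a]; replacing [x] by [y * y] moves
    the sequence into [a ^ 2] with the same length and radical. *)
Lemma exists_sop : cd a M = ara a M ->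
  exists2 s, sop a M s & [set` s] `<=` ideal_pow a 2.
Proof.
move=> /cd_ara_generators [s [sE srad]].
have sx x : x \in s -> exists2 y, a y & exists n, forall m : M, x ^+ n *: m = y *: m.
  move=> xs; have : radical_mod (annihilator M) (ideal_gen s) x.
    by exists 1%N, x; [exact: mem_ideal_gen|rewrite expr1 subrr; exact: annihilator0].
  rewrite srad => -[n [y ay xy]]; exists y => //; exists n => m.
  by apply/eqP; rewrite -subr_eq0 -scalerBl; apply/eqP.
have [t [st ta strad]] : exists t, [/\ size t = size s, [set` t] `<=` ideal_pow a 2 &
    forall x, x \in s -> radical_mod (annihilator M) (ideal_gen t) x].
  elim: (s) sx => [|x s' IH] sx; first by exists [::].
  have [y ys|t [st ta strad]] := IH; first by apply: sx; rewrite inE ys orbT.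
  have [|y ay [n xy]] := sx x; first by rewrite inE eqxx.
  exists (y * y :: t); split=> [|z|z]; first by rewrite /= st.
  - rewrite /= inE => /orP[/eqP ->|/ta //].
    exact: (ideal_powS_mem (n := 1) ay (ideal_pow1 ay)).
  - rewrite inE => /orP[/eqP ->|/strad /radical_modP [k [w [tw zw]]]]; apply/radical_modP.
      exists (n * 2)%N, (y * y); split=> [|m]; first by apply: mem_ideal_gen; rewrite inE eqxx.
      by rewrite exprM expr2 -!scalerA !xy.
    exists k, w; split=> //; apply: (ideal_gen_min (ideal_ideal_gen _)) tw => v tv.
    by apply: mem_ideal_gen; rewrite inE [v \in t]tv orbT.
have t_a : [set` t] `<=` a by move=> z /ta; exact: ideal_pow_sub.
exists t => //; split=> //; first by rewrite st.
apply/seteqP; split=> r.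
  by move=> [n [y ty ry]]; exists n, y => //; exact: ideal_gen_min ty.
by rewrite -srad; exact: radical_mod_trans.
Qed.

Lemma sop_radical s : sop a M s -> a `<=` radical_mod (annihilator M) (ideal_gen s).
Proof.
case=> _ _ -> r ar; exists 1%N, r => //.
by rewrite expr1 subrr; exact: annihilator0.
Qed.

End ParameterSystems.

Theorem theorem4p1 (R : comPzRingType) (a : set R) (M : lmodType R) :
  noetherian R -> ideal a -> finitely_generated M -> cd a M = ara a M ->
  let cond_i := quasi_buchsbaum a M in
  let cond_ii := exists s : seq R,
    [/\ sop a M s, [set` s] `<=` ideal_pow a 2 & weak_sequence a M s] in
  let cond_iii := forall i : nat, ((i%:Z)%:E < cd a M)%E ->
    forall (r : R) (h : local_cohomology a M i), a r -> r *: h = 0 in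
  [/\ cond_i -> cond_ii,
      cond_ii -> cond_iii &
      a `<=` jacobson_radical R -> cond_iii -> cond_i].
Proof.
move=> noeR ia fgM cdE cond_i cond_ii cond_iii; split.
- move=> [_ qb]; have [s ssop s2] := exists_sop noeR ia cdE.
  by exists s; split=> //; exact: qb.
- move=> [s [[szE _ _] s2 ws]] i; rewrite -szE lte_fin ltz_nat => ilt r h ar.
  move: h; apply/kills_torsion_cohomology.
  exact: (weak_sequence_kills noeR ia s2 ws).
- move=> aJ c3; split=> // s ssop s2.
  apply: (kills_weak_sequence noeR ia aJ fgM s2 (sop_radical ssop)) => n ns r ar.
  (* Condition (iii) concerns the fixed resolution and is transferred to the satellites; degrees
     below [size s] are those below [cd a M]. *)
  apply/(kills_torsion_cohomology a (injective_resolution_of M)) => h; apply: c3 => //.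
  by case: ssop => <- _ _; rewrite lte_fin ltz_nat.
Qed.
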